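(* There is an algorithm that, given an instance $((G,\tau),S,k,h)$ of $\mathrm{MinReachDelete}$ where $(G,\tau)$ has lifetime $\Lambda$, decides whether it is a yes-instance in time $\mathcal{O}(w^2 h 2^{w^2}\Lambda)$, where $w=\mathrm{vimw}(G,\tau)$.
   Context: A temporal graph is a pair $(G,\tau)$ where $G$ is a finite simple graph and $\tau: E(G)\to 2^{\mathbb{N}}$ assigns to each edge $e$ a finite set $\tau(e)$ of times at which $e$ is active; $(e,t)$ with $t\in\tau(e)$ is a time-edge. The lifetime is $\Lambda=\max_e\max\tau(e)$. A (strict) temporal walk is a sequence of time-edges $(e_1,t_1),\dots,(e_n,t_n)$ with $e_1,\dots,e_n$ a walk in $G$ and $t_1<\dots<t_n$; a temporal path from $v$ to $u$ is such a walk from $v$ to $u$ visiting no vertex twice. A vertex $u$ is temporally reachable from $v$ if there is a temporal path from $v$ to $u$ (every vertex is reachable from itself). For $S\subseteq V(G)$, $\mathrm{reach}_{G,\tau}(S)$ is the set of vertices temporally reachable from some vertex of $S$, and its size is the temporal reachability of $S$. For a set $E'$ of time-edges, $(G,\tau)\setminus E'$ is obtained by removing $t$ from $\tau(e)$ for each $(e,t)\in E'$. $\mathrm{MinReachDelete}$: given $(G,\tau)$, $S\subseteq V(G)$ and $k,h\in\mathbb{N}$, decide whether there is a set $E'$ of time-edges with $|E'|\le k$ such that the temporal reachability of $S$ in $(G,\tau)\setminus E'$ is at most $h$. The vertex-interval-membership-width is $\mathrm{vimw}(G,\tau)=\max_{t\in[\Lambda]}|F_t|$ where $F_t=\{v\in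 V(G): \exists\, i\le t\le j \text{ and } u,w\in V(G) \text{ (not necessarily distinct) with } i\in\tau(uv),\ j\in\tau(wv)\}$. *)

(* Defs.v *)
From HB Require Import structures.
From mathcomp Require Import all_boot finmap.
From mathcomp Require Import boolp.

Set Implicit Arguments.
Unset Strict Implicit.
Unset Printing Implicit Defensive.

Local Open Scope fset_scope.

(* An edge uv is the two-element set [set u; v].  [tau] is a total function,
   empty outside the edge set.  Times are positive: they range over [Lambda],
   which starts at 1. *)
Record tgraph (V : finType) := TGraph {
  edges : {set {set V}};
  tau : {set V} -> {fset nat};
  edges_card2 : forall e, e \in edges -> #|e| = 2;
  tau_edges : forall e, e \notin edges -> tau e = fset0;
  tau_pos : forall e, 0 \notin tau e
}.

Section TemporalGraph.
Variable V : finType.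
Implicit Types (G : tgraph V) (u v w : V) (e : {set V}) (t : nat).

Definition time_edges G : seq ({set V} * nat) :=
  [seq (e, t) | e <- enum (edges G), t <- tau G e].

Definition lifetime G : nat := \max_(e in edges G) \max_(t <- tau G e) t.

(* The step (x, t) of a walk standing at v is the time-edge ([set v; x], t). *)
Fixpoint is_walk G v (p : seq (V * nat)) : bool :=
  if p is (x, t) :: p' then
    (([set v; x], t) \in time_edges G) && is_walk G x p'
  else true.

Definition temporal_walk G v u (p : seq (V * nat)) : bool :=
  [&& is_walk G v p, sorted ltn (unzip2 p) & last v (unzip1 p) == u].

Definition temporal_path G v u (p : seq (V * nat)) : bool :=
  temporal_walk G v u p && uniq (v :: unzip1 p).

Definition reachable G v u : Prop := exists p, temporal_path G v u p.

Definition reach G (S : {set V}) : {set V} :=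
  [set u | `[< exists2 v, v \in S & reachable G v u >]].

Section Delete.
Variables (G : tgraph V) (D : {fset {set V} * nat}).

Definition del_tau e : {fset nat} := [fset t in tau G e | (e, t) \notin D].

Lemma del_tau_edges e : e \notin edges G -> del_tau e = fset0.
Proof.
by move=> eG; apply/fsetP => t; rewrite !inE /= (tau_edges eG) inE.
Qed.

Lemma del_tau_pos e : 0 \notin del_tau e.
Proof. by rewrite !inE /= negb_and tau_pos. Qed.

Definition delete : tgraph V :=
  TGraph (@edges_card2 V G) del_tau_edges del_tau_pos.

End Delete.

Definition MinReachDelete G (S : {set V}) (k h : nat) : Prop :=
  exists D : {fset {set V} * nat},
    [/\ {subset D <= time_edges G}, #|` D| <= k & #|reach (delete G D) S| <= h].

Definition vim_set G t : {set V} :=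
  [set v | `[< exists i j u w,
    [/\ i <= t, t <= j, i \in tau G [set u; v] & j \in tau G [set w; v]] >]].

Definition vimw G : nat := \max_(1 <= t < (lifetime G).+1) #|vim_set G t|.

End TemporalGraph.

(* Model of computation: a random access machine with natural-number cells,
   finitely many scalar variables and finitely many unbounded arrays per
   program, programmed in structured form.  Each operation (constant, variable
   access, addition, truncated subtraction, array read, assignment, array
   write, test) costs one time unit.  Multiplication, division and bit
   operations are not primitive, so the uniform cost measure is the usual
   reasonable one. *)
Inductive expr :=
  | Cst of nat
  | Var of nat
  | Add of expr & expr
  | Sub of expr & expr
  | Read of nat & expr.

Inductive cmd :=
  | Skip
  | Assign of nat & expr
  | Write of nat & expr & expr
  | Seq of cmd & cmd
  | If of expr & cmd & cmd
  | While of expr & cmd.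

Record state := State { vars : nat -> nat; arrs : nat -> nat -> nat }.

Definition upd (T : Type) (f : nat -> T) (x : nat) (a : T) : nat -> T :=
  fun y => if y == x then a else f y.

Fixpoint eval (s : state) (e : expr) : nat :=
  match e with
  | Cst c => c
  | Var x => vars s x
  | Add e1 e2 => eval s e1 + eval s e2
  | Sub e1 e2 => eval s e1 - eval s e2
  | Read a i => arrs s a (eval s i)
  end.

Fixpoint ecost (e : expr) : nat :=
  match e with
  | Cst _ | Var _ => 1
  | Add e1 e2 | Sub e1 e2 => (ecost e1 + ecost e2).+1
  | Read _ i => (ecost i).+1
  end.

(* [exec c s T s']: started in state s, the program c halts in state s' after
   exactly T time units.  A test succeeds when its value is nonzero. *)
Inductive exec : cmd -> state -> nat -> state -> Prop :=
  | ExecSkip s : exec Skip s 1 s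
  | ExecAssign x e s :
      exec (Assign x e) s (ecost e).+1
           (State (upd (vars s) x (eval s e)) (arrs s))
  | ExecWrite a i e s :
      exec (Write a i e) s (ecost i + ecost e).+1
           (State (vars s)
                  (upd (arrs s) a (upd (arrs s a) (eval s i) (eval s e))))
  | ExecSeq c1 c2 s1 s2 s3 T1 T2 :
      exec c1 s1 T1 s2 -> exec c2 s2 T2 s3 -> exec (Seq c1 c2) s1 (T1 + T2) s3
  | ExecIfTrue e c1 c2 s s' T :
      eval s e != 0 -> exec c1 s T s' -> exec (If e c1 c2) s (ecost e + T).+1 s'
  | ExecIfFalse e c1 c2 s s' T :
      eval s e == 0 -> exec c2 s T s' -> exec (If e c1 c2) s (ecost e + T).+1 s'
  | ExecWhileTrue e c s1 s2 s3 T1 T2 :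
      eval s1 e != 0 -> exec c s1 T1 s2 -> exec (While e c) s2 T2 s3 ->
      exec (While e c) s1 (ecost e + T1 + T2).+1 s3
  | ExecWhileFalse e c s :
      eval s e == 0 -> exec (While e c) s (ecost e).+1 s.

Lemma exec_det c s T1 s1 T2 s2 :
  exec c s T1 s1 -> exec c s T2 s2 -> T1 = T2 /\ s1 = s2.
Proof.
move=> ex1; elim: ex1 T2 s2 => {c s T1 s1}.
- by move=> s T2 s2 ex2; inversion ex2.
- by move=> x e s T2 s2 ex2; inversion ex2.
- by move=> a i e s T2 s2 ex2; inversion ex2.
- move=> c1 c2 s1 s2 s3 T1 T2 _ IH1 _ IH2 T s ex2.
  inversion ex2 as [| | |? ? ? ? ? ? ? x1 x2| | | |]; subst.
  by have [? ?] := IH1 _ _ x1; subst; have [? ?] := IH2 _ _ x2; subst.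
- move=> e c1 c2 s s' T et _ IH T2 s2 ex2.
  inversion ex2 as [| | | |? ? ? ? ? ? b x|? ? ? ? ? ? b x| |]; subst.
    by have [? ?] := IH _ _ x; subst.
  by rewrite b in et.
- move=> e c1 c2 s s' T et _ IH T2 s2 ex2.
  inversion ex2 as [| | | |? ? ? ? ? ? b x|? ? ? ? ? ? b x| |]; subst.
    by rewrite et in b.
  by have [? ?] := IH _ _ x; subst.
- move=> e c s1 s2 s3 T1 T2 et _ IH1 _ IH2 T s ex2.
  inversion ex2 as [| | | | | |? ? ? ? ? ? ? b x1 x2|? ? ? b]; subst.
    by have [? ?] := IH1 _ _ x1; subst; have [? ?] := IH2 _ _ x2; subst.
  by rewrite b in et.
- move=> e c s et T2 s2 ex2.
  inversion ex2 as [| | | | | |? ? ? ? ? ? ? b x1 x2|? ? ? b]; subst => //.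
  by rewrite et in b.
Qed.

(* The input is the list of vertices of S, the list of edges of G and the list
   of time-edges, each without repetition but in arbitrary order and with
   arbitrary orientation of the edges, together with n, k, h and the lengths of
   the three lists.  All remaining cells are initially zero. *)
Definition input_state (n k h : nat) (ss : seq 'I_n) (es : seq ('I_n * 'I_n))
    (ts : seq ('I_n * 'I_n * nat)) : state :=
  State
    (nth 0 [:: n; k; h; size ss; size es; size ts])
    (fun a => nth 0 (nth [::]
      [:: [seq val x | x <- ss];
          [seq val x.1 | x <- es]; [seq val x.2 | x <- es];
          [seq val x.1.1 | x <- ts]; [seq val x.1.2 | x <- ts];
          [seq x.2 | x <- ts]] a)).

Definition encodes (n : nat) (G : tgraph 'I_n) (S : {set 'I_n}) (k h : nat)
    (s : state) : Prop :=
  exists ss es ts,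
    [/\ perm_eq ss (enum S),
        perm_eq [seq [set x.1; x.2]%SET | x <- es] (enum (edges G)),
        perm_eq [seq ([set x.1.1; x.1.2]%SET, x.2) | x <- ts] (time_edges G)
      & s = input_state k h ss es ts].

Definition accepts (s : state) : bool := vars s 0 != 0.

(* Main.v *)
Require Import Defs.
From mathcomp Require Import all_boot.
From mathcomp Require Import finmap boolp zify.
From Stdlib Require Import FunctionalExtensionality.

(** An instance is positive iff there is an assignment of infection times
    [f : V -> nat], zero on the sources and never (larger than the lifetime)
    for all but at most [h] vertices, such that at most [k] time-edges
    [(uv, t)] satisfy [f u < t < f v] or [f v < t < f u]: those are the
    time-edges that must be deleted, and earliest arrival times give such an
    [f].  Moreover [f v] may be restricted to the times [t] with [v] in [F_t].

    The optimal [f] is found by dynamic programming over time.  The table for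
    time [t] is indexed by the infected subset of the vertices of [F_t] that are
    still active after [t] and by the number [r <= h] of infected vertices; it
    stores the best remaining budget [k + 1 - cost], with [0] for infeasible.  A
    step enumerates the [3 ^ #|F_t|] ways to place the vertices of [F_t] before,
    at, or after [t], and [3 ^ w <= 2 ^ (w ^ 2)] as soon as a time-edge exists,
    since then [w >= 2]. *)

Set Implicit Arguments.
Unset Strict Implicit.
Unset Printing Implicit Defensive.

(** * Positional codes *)

Section PositionalCode.
Variables (T : eqType) (b : nat).
Implicit Types (l : seq T) (d : T -> nat) (u v : T).

Fixpoint code l d : nat := if l is u :: l' then d u + b * code l' d else 0.

Definition digit l q u : nat := (q %/ b ^ index u l) %% b.

Definition weight c l u : nat := if u \in l then c * b ^ index u l else 0.

Lemma ltn_digit l q u : 0 < b -> digit l q u < b.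
Proof. exact: ltn_pmod. Qed.

Lemma ltn_code l d : (forall u, d u < b) -> code l d < b ^ size l.
Proof.
move=> d_lt; elim: l => //= u l IHl.
by have := d_lt u; rewrite expnS; nia.
Qed.

Lemma eq_in_code l d d' : {in l, d =1 d'} -> code l d = code l d'.
Proof.
elim: l => //= u l IHl dd'; rewrite dd' ?mem_head // IHl // => v vl.
by rewrite dd' // inE vl orbT.
Qed.

Lemma digit_code l d : uniq l -> (forall u, d u < b) ->
  {in l, digit l (code l d) =1 d}.
Proof.
rewrite /digit => + d_lt; elim: l => //= u l IHl /andP[ul Ul] v.
have b_gt0 : 0 < b by apply: leq_ltn_trans (d_lt u).
rewrite inE addnC mulnC => /predU1P[->|vl].
  by rewrite eqxx expn0 divn1 modnMDl modn_small.
rewrite ifN; last by apply: contraNneq ul => ->.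
by rewrite expnS divnMA divnMDl // (divn_small (d_lt u)) addn0 IHl.
Qed.

Lemma code_inj l d d' : uniq l -> (forall u, d u < b) -> (forall u, d' u < b) ->
  code l d = code l d' -> {in l, d =1 d'}.
Proof.
move=> Ul d_lt d'_lt eq_dd' u ul.
by rewrite -(digit_code Ul d_lt) // eq_dd' digit_code.
Qed.

Lemma codeE l d : uniq l -> code l d = \sum_(u <- l) d u * b ^ index u l.
Proof.
elim: l => [|u l IHl] /=; first by rewrite big_nil.
case/andP=> ul Ul; rewrite big_cons eqxx muln1 IHl // big_distrr /=.
congr (_ + _); rewrite big_seq [RHS]big_seq; apply: eq_bigr => v vl.
by rewrite ifN ?expnS 1?mulnCA //; apply: contraNneq ul => ->.
Qed.

Lemma sum_weight c l l' (p : pred T) : uniq l -> uniq l' -> {subset l <= l'} ->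
  \sum_(u <- l' | p u) weight c l u = c * code l p.
Proof.
move=> Ul Ul' sub_ll'; rewrite codeE // big_distrr /=.
transitivity (\sum_(u <- l' | u \in l) c * (p u * b ^ index u l)).
  rewrite big_mkcond [RHS]big_mkcond; apply: eq_bigr => u _; rewrite /weight.
  by case: (p u); case: (u \in l); rewrite ?mul1n ?mul0n ?muln0.
rewrite -big_filter; apply/perm_big/uniq_perm; rewrite ?filter_uniq // => u.
by rewrite mem_filter andb_idr //; apply: sub_ll'.
Qed.

Lemma weight_rcons c l u v : u \notin l -> weight c (rcons l u) v =
  if v == u then c * b ^ size l else weight c l v.
Proof.
move=> ul; rewrite /weight mem_rcons inE -cats1 index_cat.
have [->|_] := eqVneq v u; first by rewrite (negbTE ul) /= eqxx addn0.
by case: (v \in l).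
Qed.

Lemma modn_expS q i : q %% b ^ i.+1 = (q %/ b ^ i) %% b * b ^ i + q %% b ^ i.
Proof.
rewrite {1}(divn_eq (q %% b ^ i.+1) (b ^ i)) expnS modn_divl.
by rewrite modn_dvdm // dvdn_mull.
Qed.

End PositionalCode.

(** * Infection times *)

Definition lists (T : eqType) (l : seq T) (p : pred T) : Prop :=
  uniq l /\ forall u, (u \in l) = p u.

Section InfectionTimes.
Variables (V : eqType) (ss : seq V) (ts : seq (V * V * nat)).
Implicit Types (f : V -> nat) (u : V) (x : V * V * nat) (t : nat).

Definition ends x : seq V := [:: x.1.1; x.1.2].

Definition verts : seq V := undup (flatten (map ends ts)).
Definition seen t u : bool := has (fun x => (x.2 <= t) && (u \in ends x)) ts.
Definition last_time u : nat := \max_(x <- ts | u \in ends x) x.2.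
Definition max_time : nat := \max_(x <- ts) x.2.

(* [active t] is the paper's [F_t], and [alive t] its intersection with
   [F_(t+1)]. *)
Definition active t u : bool := seen t u && (t <= last_time u).
Definition alive t u : bool := seen t u && (t < last_time u).

Definition admissible f : Prop :=
  (forall u, u \in ss -> f u = 0) /\
  (forall u, u \notin ss -> 0 < f u /\ (f u <= max_time -> active (f u) u)).

Definition infected t f : nat :=
  size ss + count (fun u => (u \notin ss) && (f u <= t)) verts.

Definition cut f x : bool :=
  (f x.1.1 < x.2 < f x.1.2) || (f x.1.2 < x.2 < f x.1.1).

Definition deletions t f : nat := count (fun x => (x.2 <= t) && cut f x) ts.

Definition feasible (k h : nat) : Prop := exists f,
  [/\ admissible f, infected max_time f <= h & deletions max_time f <= k].

Lemma seen_le t t' u : t <= t' -> seen t u -> seen t' u.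
Proof.
move=> tt' /hasP[x xts /andP[xt ux]]; apply/hasP; exists x => //.
by rewrite ux (leq_trans xt tt').
Qed.

Lemma time_le_max x : x \in ts -> x.2 <= max_time.
Proof. by move=> xts; apply: (leq_bigmax_seq (F := snd)). Qed.

Lemma max_time_gt0 : {in ts, forall x, 0 < x.2} -> 0 < size ts -> 0 < max_time.
Proof.
move=> pos; rewrite -has_predT => /hasP[x xts _].
exact: leq_trans (pos x xts) (time_le_max xts).
Qed.

Lemma last_time_le_max u : last_time u <= max_time.
Proof. by apply/bigmax_leqP_seq => x xts _; apply: time_le_max. Qed.

Lemma active_end x u : x \in ts -> u \in ends x -> active x.2 u.
Proof.
move=> xts ux; apply/andP; split; first by apply/hasP; exists x; rewrite ?leqnn.
exact: (leq_bigmax_seq (F := snd)).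
Qed.

Lemma alive_active t u : alive t u -> active t u.
Proof. by case/andP=> su /ltnW lu; apply/andP. Qed.

Lemma alive_active_next t u : alive t u -> active t.+1 u.
Proof. by case/andP=> su lu; rewrite /active lu (seen_le (leqnSn t)). Qed.

Lemma active_verts t u : active t u -> u \in verts.
Proof.
case/andP=> /hasP[x xts /andP[_ ux]] _; rewrite mem_undup; apply/flattenP.
by exists (ends x) => //; apply: map_f.
Qed.

Definition touched (xs : seq (V * V * nat)) : pred V :=
  fun u => has (fun x => u \in ends x) xs.

Lemma touched_rcons xs x u : touched (rcons xs x) u =
  (touched xs u || (u == x.1.1)) || (u == x.1.2).
Proof. by rewrite /touched has_rcons !inE orbC orbA. Qed.

Lemma seenS t u :
  seen t.+1 u = seen t u || touched [seq x <- ts | x.2 == t.+1] u.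
Proof.
rewrite /touched has_filter -filter_predI -has_filter -has_predU.
apply: eq_has => x /=; case: (u \in ends x); last by rewrite !andbF.
by rewrite !andbT leq_eqVlt orbC.
Qed.

Lemma activeS t u :
  active t.+1 u = alive t u || touched [seq x <- ts | x.2 == t.+1] u.
Proof.
rewrite /active /alive seenS.
case: (boolP (touched _ u)) => [|_]; last by rewrite !orbF.
rewrite !orbT => /hasP[x]; rewrite mem_filter => /andP[/eqP <- xts] ux.
by case/andP: (active_end xts ux).
Qed.

Lemma activeP t u : 0 < t ->
  reflect (exists x y, [/\ x \in ts, y \in ts, u \in ends x, u \in ends y
             & x.2 <= t <= y.2])
          (active t u).
Proof.
move=> t_gt0; apply: (iffP andP) => [[/hasP[x xts /andP[xt ux]] tu]|].
  have [y yts /andP[uy ty]] :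
      exists2 y, y \in ts & (u \in ends y) && (t <= y.2).
    apply/hasP/(contraTT _ tu) => /hasPn late.
    rewrite -ltnNge -(prednK t_gt0) ltnS; apply/bigmax_leqP_seq => y yts uy.
    by have := late y yts; rewrite uy /= -ltnNge -{1}(prednK t_gt0).
  by exists x, y; split=> //; rewrite xt.
case=> x [y [xts yts ux uy /andP[xt ty]]]; split.
  by apply/hasP; exists x; rewrite ?xt.
by case/andP: (active_end yts uy) => _; apply: leq_trans.
Qed.

Lemma size_lists_active t (l : seq V) :
  lists l (active t) -> size l = count (active t) verts.
Proof.
case=> Ul lE; rewrite -size_filter; apply/perm_size/uniq_perm => // [|u].
  by rewrite filter_uniq ?undup_uniq.
by rewrite mem_filter lE andb_idr //; apply: active_verts.
Qed.

Lemma feasible_no_source k h : ss = [::] -> feasible k h.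
Proof.
move=> ss0; exists (fun=> max_time.+1); split.
- by split=> u; rewrite ?ss0 // ltnn.
- rewrite /infected ss0 (@eq_count _ _ pred0) ?count_pred0 // => u.
  by rewrite /= ltnn.
- rewrite /deletions (@eq_count _ _ pred0) ?count_pred0 // => x.
  by rewrite /= /cut; lia.
Qed.

Lemma feasible_no_edge k h : ts = [::] -> size ss <= h -> feasible k h.
Proof.
rewrite /feasible /infected /deletions /admissible /max_time /verts.
move=> -> ss_h; exists (fun u => u \notin ss : nat).
by rewrite big_nil addn0; split=> //; split=> u ->.
Qed.

Lemma feasible_sources_le k h : feasible k h -> size ss <= h.
Proof. by case=> f [_ + _]; apply: leq_trans; apply: leq_addr. Qed.

End InfectionTimes.

Section Relabel.
Variables (V : finType) (W : eqType) (g : V -> W).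
Hypothesis g_inj : injective g.

Definition relabel (x : V * V * nat) : W * W * nat := (g x.1.1, g x.1.2, x.2).

Variables (ss : seq V) (ts : seq (V * V * nat)).

Lemma max_time_map : max_time (map relabel ts) = max_time ts.
Proof. by rewrite /max_time big_map. Qed.

Lemma verts_map : verts (map relabel ts) = map g (verts ts).
Proof.
rewrite /verts -(undup_map_inj g_inj) map_flatten -!map_comp.
by congr (undup (flatten _)); apply: eq_map.
Qed.

Lemma active_map t u : active (map relabel ts) t (g u) = active ts t u.
Proof.
have endE x : (g u \in ends (relabel x)) = (u \in ends x).
  exact: (mem_map g_inj (ends x)).
rewrite /active /seen /last_time has_map big_map; congr (_ && (_ <= _)).
  by apply: eq_has => x /=; rewrite endE.
by apply: eq_bigl.
Qed.

Lemma count_active_map t :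
  count (active (map relabel ts) t) (verts (map relabel ts)) =
  count (active ts t) (verts ts).
Proof. by rewrite verts_map count_map; apply/eq_count/active_map. Qed.

Lemma infected_map t f :
  infected (map g ss) (map relabel ts) t f = infected ss ts t (f \o g).
Proof.
rewrite /infected size_map verts_map count_map; congr (_ + _).
by apply: eq_count => u /=; rewrite mem_map.
Qed.

Lemma deletions_map t f :
  deletions (map relabel ts) t f = deletions ts t (f \o g).
Proof. exact: count_map. Qed.

Lemma admissible_comp f :
  admissible (map g ss) (map relabel ts) f -> admissible ss ts (f \o g).
Proof.
case=> src_f adm_f; split=> u uss /=; first by rewrite src_f ?map_f.
by rewrite -max_time_map -active_map; apply: adm_f; rewrite mem_map.
Qed.

Lemma admissible_extension f : admissible ss ts f ->
  exists2 f', admissible (map g ss) (map relabel ts) f' & f' \o g = f.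
Proof.
case=> src_f adm_f; pose f' w := oapp f (max_time ts).+1 [pick v | g v == w].
have f'E u : f' (g u) = f u.
  by rewrite /f'; case: pickP => [v /eqP/g_inj-> //|/(_ u)]; rewrite eqxx.
exists f'; last exact: functional_extensionality.
split=> [_ /mapP[u uss ->]|w wss]; first by rewrite f'E src_f.
have [/existsP[u /eqP wE]|/existsPn no_u] := boolP [exists u, g u == w].
  by move: wss; rewrite -wE mem_map // f'E max_time_map active_map => /adm_f.
rewrite /f'; case: pickP => [v|_] /=; first by rewrite (negbTE (no_u v)).
by rewrite max_time_map ltnn.
Qed.

Lemma feasible_map k h :
  feasible (map g ss) (map relabel ts) k h <-> feasible ss ts k h.
Proof.
split=> [[f [/admissible_comp adm_f]]|[f []]].
  by rewrite infected_map deletions_map max_time_map; exists (f \o g).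
case/admissible_extension=> f' adm_f' <-.
by rewrite -infected_map -deletions_map -max_time_map; exists f'.
Qed.

End Relabel.

(** * The recurrence *)

Section Recurrence.
Variables (V : eqType) (ss : seq V) (ts : seq (V * V * nat)) (k h : nat).
Implicit Types (f d : V -> nat) (u : V) (x : V * V * nat).
Implicit Types (t r q : nat) (K : seq V) (T : nat -> nat).

(* 2: infected before time t, 1: infected at time t, 0: not yet infected. *)
Definition phase t f u : nat := (f u <= t) + (f u < t).

(* Equals 1 if the phases of the endpoints are 0 and 2, and 0 otherwise. *)
Definition crossing d x : nat :=
  (d x.1.1 - d x.1.2 - 1) + (d x.1.2 - d x.1.1 - 1).

Lemma crossing_phase f x : crossing (phase x.2 f) x = cut f x.
Proof. by rewrite /crossing /phase /cut; lia. Qed.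

(* The unit [h.+1] leaves room for the number of infected vertices.  Sets are
   coded in base 3, like phases, so that one table of powers serves for both. *)
Definition cell t K f : nat :=
  h.+1 * code 3 K (fun u => f u <= t) + infected ss ts t f.

Definition table_sound t K T : Prop := forall i, 0 < T i -> exists f,
  [/\ admissible ss ts f, infected ss ts t f <= h,
      T i + deletions ts t f <= k.+1
    & i = cell t K f].

Definition table_complete t K T : Prop := forall f,
  admissible ss ts f -> infected ss ts t f <= h ->
  k.+1 <= T (cell t K f) + deletions ts t f.

Definition table_correct t K T : Prop :=
  table_sound t K T /\ table_complete t K T.

Section Transition.
Variables (t : nat) (K B N : seq V).
Hypotheses (aliveK : lists K (alive ts t)) (activeB : lists B (active ts t.+1))
  (aliveN : lists N (alive ts t.+1)).

(* Here [d] gives the phases at time [t.+1]; [src] and [dst] are the codes of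
   the infected sets before and after that time. *)
Definition src d : nat := h.+1 * code 3 K (fun u => d u == 2).
Definition dst d : nat := h.+1 * code 3 N (fun u => 0 < d u).
Definition fresh (l : seq V) d : nat := count (fun u => d u == 1) l.

(* A vertex that becomes active is infected at that moment iff it is a
   source. *)
Definition misplaced d u : bool :=
  if d u == 2 then (u \notin K) && (u \notin ss) else u \in ss.

(* Misplacing a vertex costs more than the whole budget. *)
Definition penalty (l : seq V) d : nat :=
  if has (misplaced d) l then k.+1 else 0.

Definition charge d : nat :=
  penalty B d + \sum_(x <- ts | x.2 == t.+1) crossing d x.

Lemma subset_alive_active : {subset K <= B}.
Proof. by move=> u; rewrite aliveK.2 activeB.2 => /alive_active_next. Qed.

Lemma subset_next_alive_active : {subset N <= B}.
Proof. by move=> u; rewrite aliveN.2 activeB.2 => /alive_active. Qed.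

Lemma leq_size_alive : size K <= size B.
Proof. exact: uniq_leq_size aliveK.1 subset_alive_active. Qed.

Lemma leq_size_next_alive : size N <= size B.
Proof. exact: uniq_leq_size aliveN.1 subset_next_alive_active. Qed.

Lemma end_mem_active x u : x \in ts -> x.2 = t.+1 -> u \in ends x -> u \in B.
Proof. by move=> xts xt ux; rewrite activeB.2 -xt active_end. Qed.

Lemma eq_in_src d d' : {in B, d =1 d'} -> src d = src d'.
Proof.
move=> dd'; congr (_ * _); apply: eq_in_code => u uK.
by rewrite dd' // subset_alive_active.
Qed.

Lemma eq_in_dst d d' : {in B, d =1 d'} -> dst d = dst d'.
Proof.
move=> dd'; congr (_ * _); apply: eq_in_code => u uN.
by rewrite dd' // subset_next_alive_active.
Qed.

Lemma eq_in_fresh d d' : {in B, d =1 d'} -> fresh B d = fresh B d'.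
Proof. by move=> dd'; apply: eq_in_count => u /dd' ->. Qed.

Lemma eq_in_charge d d' : {in B, d =1 d'} -> charge d = charge d'.
Proof.
move=> dd'; rewrite /charge /penalty; congr ((if _ then _ else _) + _).
  by apply: eq_in_has => u /dd'; rewrite /misplaced => ->.
rewrite big_seq_cond [RHS]big_seq_cond; apply: eq_bigr => x /andP[xts /eqP xt].
by rewrite /crossing !dd' // (end_mem_active xts) // !inE eqxx ?orbT.
Qed.

Lemma src_phase f : src (phase t.+1 f) = h.+1 * code 3 K (fun u => f u <= t).
Proof. by congr (_ * _); apply: eq_in_code => u _; rewrite /phase; lia. Qed.

Lemma dst_phase f : dst (phase t.+1 f) = h.+1 * code 3 N (fun u => f u <= t.+1).
Proof. by congr (_ * _); apply: eq_in_code => u _; rewrite /phase; lia. Qed.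

Hypothesis t_lt_max : t < max_time ts.

Lemma admissible_alive f u : admissible ss ts f -> u \in B -> u \notin ss ->
  f u <= t -> u \in K.
Proof.
move=> [_ adm_f] uB uss fu; have [_] := adm_f u uss.
case/(_ (leq_trans fu (ltnW t_lt_max)))/andP => /(seen_le fu) su _.
by move: uB; rewrite activeB.2 aliveK.2 /alive su => /andP[_ ->].
Qed.

Lemma fresh_phase f : admissible ss ts f ->
  fresh B (phase t.+1 f) =
    count (fun u => (u \notin ss) && (f u == t.+1)) (verts ts).
Proof.
move=> adm_f; rewrite /fresh -!size_filter; apply/perm_size/uniq_perm.
- by rewrite filter_uniq // activeB.1.
- by rewrite filter_uniq // undup_uniq.
move=> u; rewrite !mem_filter activeB.2.
have -> : (phase t.+1 f u == 1) = (f u == t.+1) by rewrite /phase; lia.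
case: eqP => [fu|]; last by rewrite andbF.
rewrite andbT /=; have [uss|uss] := boolP (u \in ss).
  by rewrite (adm_f.1 u uss) in fu.
have [_] := adm_f.2 u uss; rewrite fu => /(_ t_lt_max) au.
by rewrite au (active_verts au).
Qed.

Lemma infectedS f : admissible ss ts f ->
  infected ss ts t.+1 f = infected ss ts t f + fresh B (phase t.+1 f).
Proof.
move=> adm_f; rewrite fresh_phase // /infected -addnA; congr (_ + _).
rewrite -count_predUI [X in _ + X](@eq_count _ _ pred0) ?count_pred0 ?addn0.
  by apply: eq_count => u /=; case: (u \in ss) => //=; lia.
by move=> u /=; case: (u \in ss) => //=; lia.
Qed.

Lemma penalty_phase f : admissible ss ts f -> penalty B (phase t.+1 f) = 0.
Proof.
move=> adm_f; rewrite /penalty ifF //; apply/hasPn => u uB.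
rewrite /misplaced; have [uss|uss] := boolP (u \in ss).
  by rewrite /phase (adm_f.1 u uss) andbF.
rewrite andbT; case: eqP => //= phase2; rewrite negbK.
by apply: (admissible_alive adm_f uB uss); move: phase2; rewrite /phase; lia.
Qed.

Lemma deletionsS f : admissible ss ts f ->
  deletions ts t.+1 f = deletions ts t f + charge (phase t.+1 f).
Proof.
move=> adm_f; rewrite /deletions /charge penalty_phase // add0n -!sum1_count.
rewrite (bigID (fun x => x.2 <= t)) /=; congr (_ + _).
  by apply: eq_bigl => x; case: (cut f x) => /=; lia.
rewrite big_mkcond [RHS]big_mkcond; apply: eq_bigr => x _.
rewrite -ltnNge eqn_leq; case: (leqP t.+1 x.2) => [tx|_];
  last by rewrite !andbF.
rewrite !andbT; case: leqP => //= xt.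
have <- : x.2 = t.+1 by lia.
by rewrite crossing_phase; case: cut.
Qed.

Lemma cellS f : admissible ss ts f ->
  cell t.+1 N f =
    dst (phase t.+1 f) + (infected ss ts t f + fresh B (phase t.+1 f)).
Proof. by move=> adm_f; rewrite /cell infectedS // dst_phase. Qed.

Section Extension.
Variables (f d : V -> nat).

Definition extend u : nat :=
  if f u <= t then f u
  else if (u \in B) && (d u == 1) then t.+1 else (max_time ts).+1.

Lemma leq_extend s u : s <= t -> (extend u <= s) = (f u <= s).
Proof. by move=> st; rewrite /extend; do 2!case: ifP => //; lia. Qed.

Lemma ltn_extend s u : s <= t -> (extend u < s) = (f u < s).
Proof. by case: s => // s /ltnW st; rewrite !ltnS leq_extend. Qed.

Lemma infected_extend : infected ss ts t extend = infected ss ts t f.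
Proof. by congr (_ + _); apply: eq_count => u; rewrite leq_extend. Qed.

Lemma deletions_extend : deletions ts t extend = deletions ts t f.
Proof.
apply: eq_count => x; case: leqP => //= xt.
by rewrite /cut ![x.2 < _]ltnNge !leq_extend ?ltn_extend.
Qed.

Hypotheses (adm_f : admissible ss ts f) (d_lt3 : forall u, d u < 3)
  (placed : ~~ has (misplaced d) B)
  (src_d : src d = h.+1 * code 3 K (fun u => f u <= t)).

Lemma eq2_infected u : u \in B -> (d u == 2) = (f u <= t).
Proof.
move=> uB; have := hasPn placed u uB; rewrite /misplaced.
have [uK _|uK] := boolP (u \in K) => /=.
  have bool_lt3 (b : bool) : b < 3 by case: b.
  have eqK : code 3 K (fun u => d u == 2) = code 3 K (fun u => f u <= t).
    by apply/eqP; rewrite -(@eqn_pmul2l h.+1) // -src_d.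
  have := code_inj aliveK.1 (fun u => bool_lt3 (d u == 2))
            (fun u => bool_lt3 (f u <= t)) eqK uK.
  by case: (d u == 2); case: (f u <= t).
have [uss|uss] := boolP (u \in ss); first by rewrite (adm_f.1 _ uss); case: eqP.
case: eqP => //= _ _; apply/esym/negP => fu.
by rewrite (admissible_alive adm_f uB uss fu) in uK.
Qed.

Lemma admissible_extend : admissible ss ts extend.
Proof.
split=> u uss; first by rewrite /extend (adm_f.1 u uss).
rewrite /extend; case: ifP => fu; first exact: adm_f.2.
case: ifP => [/andP[uB _]|_]; last by split=> //; rewrite ltnn.
by split=> // _; rewrite -activeB.2.
Qed.

Lemma phase_extend : {in B, d =1 phase t.+1 extend}.
Proof.
move=> u uB; have := eq2_infected uB; have := d_lt3 u.
rewrite /phase /extend uB /=; case: (leqP (f u) t) => fu /=; first by lia.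
by case: (d u =P 1) => [->|]; lia.
Qed.

End Extension.

Definition relax_complete j T T' : Prop :=
  forall q r, let d := digit 3 B q in q < j -> r + fresh B d <= h ->
    T (src d + r) - charge d <= T' (dst d + (r + fresh B d)).

Definition relax_sound T T' : Prop :=
  forall i, 0 < T' i -> exists q r, let d := digit 3 B q in
    [/\ r + fresh B d <= h, i = dst d + (r + fresh B d)
      & T' i <= T (src d + r) - charge d].

Lemma table_soundS T T' : table_sound t K T -> relax_sound T T' ->
  table_sound t.+1 N T'.
Proof.
move=> soundT soundT' i T'i; have [q [r [r_h iE T'i_le]]] := soundT' i T'i.
set d := digit 3 B q in r_h iE T'i_le.
have [f [adm_f inf_f del_f cell_f]] : exists f, [/\ admissible ss ts f,
    infected ss ts t f <= h, T (src d + r) + deletions ts t f <= k.+1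
    & src d + r = cell t K f].
  by apply: soundT; lia.
have [srcE rE] : src d = h.+1 * code 3 K (fun u => f u <= t) /\
    r = infected ss ts t f.
  have r_lt : r < h.+1 by apply: leq_trans r_h; rewrite leq_addr.
  move/(congr1 (edivn^~ h.+1)): cell_f; rewrite /cell /src ![h.+1 * _]mulnC.
  by rewrite !edivn_eq // => -[-> ->].
have d_lt3 u : d u < 3 by apply: ltn_digit.
have placed : ~~ has (misplaced d) B.
  by apply/negP => mis; move: T'i_le; rewrite /charge /penalty mis; lia.
have adm_f' := admissible_extend d adm_f.
have dE := phase_extend adm_f d_lt3 placed srcE.
exists (extend f d); split=> //.
- by rewrite infectedS // infected_extend -(eq_in_fresh dE) -rE.
- by rewrite deletionsS // deletions_extend -(eq_in_charge dE); lia.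
- by rewrite cellS // infected_extend -(eq_in_fresh dE) -(eq_in_dst dE) -rE.
Qed.

Lemma table_completeS T T' : table_complete t K T ->
  relax_complete (3 ^ size B) T T' -> table_complete t.+1 N T'.
Proof.
move=> complT complT' f adm_f; rewrite infectedS // deletionsS // cellS //.
set d := phase t.+1 f => inf_f.
have d_lt3 u : d u < 3 by rewrite /d /phase; lia.
have dE := digit_code activeB.1 d_lt3.
have := complT' (code 3 B d) (infected ss ts t f) (ltn_code _ d_lt3).
rewrite (eq_in_src dE) (eq_in_dst dE) (eq_in_fresh dE) (eq_in_charge dE).
have := complT f adm_f (leq_trans (leq_addr _ _) inf_f).
by rewrite src_phase /cell; lia.
Qed.

Lemma table_correctS T T' : table_correct t K T -> relax_sound T T' ->
  relax_complete (3 ^ size B) T T' -> table_correct t.+1 N T'.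
Proof.
move=> [sound compl] soundT complT; split; first exact: table_soundS soundT.
exact: table_completeS complT.
Qed.

End Transition.

Hypothesis ts_pos : forall x, x \in ts -> 0 < x.2.

Lemma seen0 u : seen ts 0 u = false.
Proof. by apply/negbTE/hasPn => x xts; rewrite leqNgt ts_pos. Qed.

Lemma lists_alive0 : lists [::] (alive ts 0).
Proof. by split=> // u; rewrite /alive seen0. Qed.

Lemma lists_alive_max K : lists K (alive ts (max_time ts)) -> K = [::].
Proof.
case: K => // u K [_ /(_ u)].
by rewrite mem_head /alive ltnNge last_time_le_max andbF.
Qed.

Lemma infected0 f : admissible ss ts f -> infected ss ts 0 f = size ss.
Proof.
move=> adm_f; rewrite /infected (@eq_count _ _ pred0) ?count_pred0 ?addn0 //.
move=> u /=; have [//|uss] := boolP (u \in ss).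
by have [] := adm_f.2 u uss; case: (f u).
Qed.

Lemma deletions0 f : deletions ts 0 f = 0.
Proof.
apply/eqP; rewrite -leqn0 leqNgt -has_count; apply/hasPn => x xts.
by rewrite leqNgt ts_pos.
Qed.

Lemma table_correct0 : size ss <= h ->
  table_correct 0 [::] (fun i => if i == size ss then k.+1 else 0).
Proof.
move=> ss_h; split=> [i|f adm_f _]; last first.
  by rewrite /cell infected0 //= muln0 add0n eqxx leq_addr.
case: eqP => // -> _; pose f u := if u \in ss then 0 else (max_time ts).+1.
have adm_f : admissible ss ts f.
  split=> u uss; first by rewrite /f uss.
  by rewrite /f (negbTE uss) ltnn.
by exists f; rewrite /cell infected0 // deletions0 muln0 addn0.
Qed.

Lemma table_correct_feasible T : table_correct (max_time ts) [::] T ->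
  (exists2 r, r <= h & 0 < T r) <-> feasible ss ts k h.
Proof.
case=> sound compl.
split=> [[r _ Tr]|[f [adm_f inf_f del_f]]].
  have [f [adm_f inf_f del_f _]] := sound r Tr.
  by exists f; split=> //; lia.
exists (infected ss ts (max_time ts) f) => //.
by have := compl f adm_f inf_f; rewrite /cell muln0 add0n; lia.
Qed.

End Recurrence.

(** * Running time of structured programs *)

Fixpoint mod_vars (c : cmd) : seq nat :=
  match c with
  | Assign x _ => [:: x]
  | Seq c1 c2 | If _ c1 c2 => mod_vars c1 ++ mod_vars c2
  | While _ c => mod_vars c
  | _ => [::]
  end.

Fixpoint mod_arrs (c : cmd) : seq nat :=
  match c with
  | Write a _ _ => [:: a]
  | Seq c1 c2 | If _ c1 c2 => mod_arrs c1 ++ mod_arrs c2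
  | While _ c => mod_arrs c
  | _ => [::]
  end.

Definition frame (c : cmd) (s s' : state) : Prop :=
  (forall x, x \notin mod_vars c -> vars s' x = vars s x) /\
  (forall a, a \notin mod_arrs c -> arrs s' a = arrs s a).

Definition keeps (xs xa : seq nat) (c : cmd) : bool :=
  all (fun x => x \notin mod_vars c) xs &&
  all (fun a => a \notin mod_arrs c) xa.

Lemma frame_keeps xs xa c s s' : frame c s s' -> keeps xs xa c ->
  {in xs, forall x, vars s' x = vars s x} /\
  {in xa, forall a, arrs s' a = arrs s a}.
Proof.
move=> [fv fa] /andP[/allP kv /allP ka].
by split=> x xin; rewrite ?fv ?fa // ?kv ?ka.
Qed.

Lemma frame_assign c x a s :
  x \in mod_vars c -> frame c s (State (upd (vars s) x a) (arrs s)).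
Proof.
move=> xc; split=> //= y yc.
by rewrite /upd ifN //; apply: contraNneq yc => ->.
Qed.

Lemma frame_trans c s1 s2 s3 : frame c s1 s2 -> frame c s2 s3 -> frame c s1 s3.
Proof.
by move=> [fv1 fa1] [fv2 fa2]; split=> x xc; rewrite ?fv2 ?fv1 // ?fa2 ?fa1.
Qed.

Lemma frame_seq c1 c2 s1 s2 s3 :
  frame c1 s1 s2 -> frame c2 s2 s3 -> frame (Seq c1 c2) s1 s3.
Proof.
move=> [fv1 fa1] [fv2 fa2].
by split=> x; rewrite mem_cat negb_or => /andP[x1 x2];
  rewrite ?fv2 ?fv1 ?fa2 ?fa1.
Qed.

Lemma exec_frame c s T s' : exec c s T s' -> frame c s s'.
Proof.
elim=> {c s T s'} //.
- by move=> x e s; split=> // y; rewrite inE /= /upd => /negbTE ->.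
- by move=> a i e s; split=> // y; rewrite inE /= /upd => /negbTE ->.
- by move=> c1 c2 s1 s2 s3 T1 T2 _ + _; apply: frame_seq.
- move=> e c1 c2 s s' T _ _ [fv fa].
  by split=> x; rewrite mem_cat negb_or => /andP[x1 x2]; rewrite ?fv ?fa.
- move=> e c1 c2 s s' T _ _ [fv fa].
  by split=> x; rewrite mem_cat negb_or => /andP[x1 x2]; rewrite ?fv ?fa.
- by move=> e c s1 s2 s3 T1 T2 _ _ + _; apply: frame_trans.
Qed.

Definition run (c : cmd) (s : state) (t : nat) (Q : state -> Prop) : Prop :=
  exists T s', [/\ exec c s T s', T <= t & Q s'].

Lemma run_weaken c s t t' (Q Q' : state -> Prop) : run c s t Q -> t <= t' ->
  (forall s', frame c s s' -> Q s' -> Q' s') -> run c s t' Q'.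
Proof.
move=> [T [s' [ex T_le Qs']]] tt' QQ'; exists T, s'; split=> //.
  exact: leq_trans tt'.
by apply: QQ' => //; apply: exec_frame ex.
Qed.

Lemma run_leq c s t t' (Q : state -> Prop) : run c s t Q -> t <= t' ->
  run c s t' Q.
Proof. by move=> run_c tt'; apply: run_weaken run_c tt' _. Qed.

Lemma run_seq c1 c2 s t1 t2 (Q1 Q2 : state -> Prop) : run c1 s t1 Q1 ->
  (forall s', frame c1 s s' -> Q1 s' -> run c2 s' t2 Q2) ->
  run (Seq c1 c2) s (t1 + t2) Q2.
Proof.
move=> [T1 [s1 [ex1 T1_le Q1s]]] run2.
have [T2 [s2 [ex2 T2_le Q2s]]] := run2 s1 (exec_frame ex1) Q1s.
by exists (T1 + T2), s2; split=> //; [apply: ExecSeq ex1 ex2 | apply: leq_add].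
Qed.

Lemma run_if e c1 c2 s t1 t2 (Q : state -> Prop) :
  (eval s e != 0 -> run c1 s t1 Q) -> (eval s e = 0 -> run c2 s t2 Q) ->
  run (If e c1 c2) s (ecost e + maxn t1 t2).+1 Q.
Proof.
move=> run1 run2; have [e0|e_neq0] := eqVneq (eval s e) 0.
  have [T [s' [ex T_le Qs]]] := run2 e0.
  exists (ecost e + T).+1, s'; split=> //.
    by apply: ExecIfFalse ex; rewrite e0.
  by rewrite ltnS leq_add2l leq_max T_le orbT.
have [T [s' [ex T_le Qs]]] := run1 e_neq0.
exists (ecost e + T).+1, s'; split=> //.
  exact: ExecIfTrue ex.
by rewrite ltnS leq_add2l leq_max T_le.
Qed.

Lemma run_while e c (I : nat -> state -> Prop) N t s :
  I 0 s ->
  (forall j s', j < N -> frame c s s' -> I j s' ->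
     eval s' e != 0 /\ run c s' t (I j.+1)) ->
  (forall s', frame c s s' -> I N s' -> eval s' e = 0) ->
  run (While e c) s (N * (t + ecost e).+1 + (ecost e).+1) (I N).
Proof.
move=> I0 body stop; suff loop n j s' : j + n = N -> frame c s s' -> I j s' ->
    run (While e c) s' (n * (t + ecost e).+1 + (ecost e).+1) (I N).
  exact: (loop N 0).
elim: n j s' => [|n IHn] j s' jN fr Ij.
  rewrite addn0 in jN; subst j; exists (ecost e).+1, s'; split=> //.
  by apply: ExecWhileFalse; rewrite (stop s' fr).
have [|e_neq0 [T1 [s1 [ex1 T1_le I1]]]] := body j s' _ fr Ij; first by lia.
have [||T2 [s2 [ex2 T2_le I2]]] := IHn j.+1 s1 _ _ I1; first by lia.
  exact: frame_trans fr (exec_frame ex1).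
exists (ecost e + T1 + T2).+1, s2; split=> //; last by lia.
exact: ExecWhileTrue e_neq0 ex1 ex2.
Qed.

Fixpoint straight (c : cmd) : bool :=
  match c with
  | Seq c1 c2 | If _ c1 c2 => straight c1 && straight c2
  | While _ _ => false
  | _ => true
  end.

Fixpoint effect (c : cmd) (s : state) : state :=
  match c with
  | Assign x e => State (upd (vars s) x (eval s e)) (arrs s)
  | Write a i e =>
      State (vars s) (upd (arrs s) a (upd (arrs s a) (eval s i) (eval s e)))
  | Seq c1 c2 => effect c2 (effect c1 s)
  | If e c1 c2 => if eval s e == 0 then effect c2 s else effect c1 s
  | _ => s
  end.

Lemma effect_seq c1 c2 s : effect (Seq c1 c2) s = effect c2 (effect c1 s).
Proof. by []. Qed.

Fixpoint max_cost (c : cmd) : nat :=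
  match c with
  | Assign _ e => (ecost e).+1
  | Write _ i e => (ecost i + ecost e).+1
  | Seq c1 c2 => max_cost c1 + max_cost c2
  | If e c1 c2 => (ecost e + maxn (max_cost c1) (max_cost c2)).+1
  | _ => 1
  end.

Lemma run_straight c s (Q : state -> Prop) :
  straight c -> Q (effect c s) -> run c s (max_cost c) Q.
Proof.
elim: c s Q => //=.
- by move=> s Q _ Qs; exists 1, s; split=> //; apply: ExecSkip.
- move=> x e s Q _ Qs; exists (ecost e).+1, (effect (Assign x e) s).
  by split=> //; apply: ExecAssign.
- move=> a i e s Q _ Qs.
  exists (ecost i + ecost e).+1, (effect (Write a i e) s).
  by split=> //; apply: ExecWrite.
- move=> c1 IHc1 c2 IHc2 s Q /andP[str1 str2] Qs.
  apply: run_seq (IHc1 s (eq (effect c1 s)) str1 (erefl _)) _ => s' _ <-.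
  exact: IHc2.
- move=> e c1 IHc1 c2 IHc2 s Q /andP[str1 str2] Qs.
  apply: run_if => test; first by apply: IHc1; rewrite ?(negbTE test) in Qs *.
  by apply: IHc2; rewrite ?test ?eqxx in Qs *.
Qed.

Lemma effect_frame c s : straight c -> frame c s (effect c s).
Proof.
case/(@run_straight c s (eq (effect c s)))=> // T [s' [/exec_frame fr _ ->]].
exact: fr.
Qed.

Lemma run_effect_seq c1 c2 s t (Q : state -> Prop) :
  straight c1 -> run c2 (effect c1 s) t Q ->
  run (Seq c1 c2) s (max_cost c1 + t) Q.
Proof.
move=> str run2.
have run1 := @run_straight c1 s (eq (effect c1 s)) str (erefl _).
by apply: run_seq run1 _ => s' _ <-.
Qed.

Lemma run_for (I : nat -> state -> Prop) N t init e c s t' (Q : state -> Prop) :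
  straight init -> I 0 (effect init s) ->
  (forall j s', j < N -> frame (Seq init (While e c)) s s' -> I j s' ->
     eval s' e != 0 /\ run c s' t (I j.+1)) ->
  (forall s', frame (Seq init (While e c)) s s' -> I N s' ->
    eval s' e = 0 /\ Q s') ->
  max_cost init + (N * (t + ecost e).+1 + (ecost e).+1) <= t' ->
  run (Seq init (While e c)) s t' Q.
Proof.
move=> str I0 body stop t_le.
have frE s' : frame c (effect init s) s' -> frame (Seq init (While e c)) s s'.
  by apply: (@frame_seq _ (While e c)); apply: effect_frame.
apply: run_weaken (run_effect_seq str (run_while I0 _ _)) t_le _.
- by move=> j s' lt_jN /frE; apply: body.
- by move=> s' /frE fr /(stop _ fr)[].
- by move=> s' fr /(stop _ fr)[].
Qed.

Lemma run_for_straight (I : nat -> state -> Prop) N init e c s t'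
    (Q : state -> Prop) :
  straight init -> straight c -> I 0 (effect init s) ->
  (forall j s', j < N -> frame (Seq init (While e c)) s s' -> I j s' ->
     eval s' e != 0 /\ I j.+1 (effect c s')) ->
  (forall s', frame (Seq init (While e c)) s s' -> I N s' ->
    eval s' e = 0 /\ Q s') ->
  max_cost init + (N * (max_cost c + ecost e).+1 + (ecost e).+1) <= t' ->
  run (Seq init (While e c)) s t' Q.
Proof.
move=> str_init str_c I0 body; apply: (run_for str_init I0) => j s' lt_jN fr Ij.
by have [e_neq0 IS] := body j s' lt_jN fr Ij; split=> //; apply: run_straight.
Qed.

(** * The program *)

(* Cells up to 5 hold the input; the result overwrites [n].  The vertices of the
   current [F_t] form the segment of length [xSize] of [aBag] at [xBag], the
   current table starts at cell [xTab] of [aTab], and [aOld] and [aNew] give the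
   weight of a vertex in the cells of the current and of the next table. *)
Local Notation xResult := 0 (only parsing).
Local Notation xK := 1 (only parsing).
Local Notation xH := 2 (only parsing).
Local Notation xNumS := 3 (only parsing).
Local Notation xNumTs := 5 (only parsing).
Local Notation xMaxTime := 6 (only parsing).
Local Notation xTime := 7 (only parsing).
Local Notation xBag := 8 (only parsing).
Local Notation xSize := 9 (only parsing).
Local Notation xNextSize := 10 (only parsing).
Local Notation xTab := 11 (only parsing).
Local Notation xNextTab := 12 (only parsing).
Local Notation xLink := 13 (only parsing).
Local Notation xI := 14 (only parsing).
Local Notation xCode := 15 (only parsing).
Local Notation xRem := 16 (only parsing).
Local Notation xDigit := 17 (only parsing).
Local Notation xSrc := 18 (only parsing).
Local Notation xDst := 19 (only parsing).
Local Notation xFresh := 20 (only parsing).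
Local Notation xCharge := 21 (only parsing).
Local Notation xR := 22 (only parsing).
Local Notation xU := 23 (only parsing).
Local Notation xV := 24 (only parsing).

Local Notation aS := 0 (only parsing).
Local Notation aU := 3 (only parsing).
Local Notation aV := 4 (only parsing).
Local Notation aTime := 5 (only parsing).
Local Notation aIsSrc := 6 (only parsing).
Local Notation aHead := 7 (only parsing).
Local Notation aNext := 8 (only parsing).
Local Notation aLast := 9 (only parsing).
Local Notation aSeen := 10 (only parsing).
Local Notation aBag := 11 (only parsing).
Local Notation aPow := 12 (only parsing).
Local Notation aOld := 13 (only parsing).
Local Notation aNew := 14 (only parsing).
Local Notation aDigit := 15 (only parsing).
Local Notation aTab := 16 (only parsing).

Local Notation "x ::= e" := (Assign x e) (at level 60, e at level 50).
Local Notation "a !! i ::= e" := (Write a i e)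
  (at level 60, i at level 50, e at level 50).
Local Notation "c1 ;; c2" := (Seq c1 c2) (at level 65, right associativity).
Local Notation "$ x" := (Var x) (at level 8, x at level 0).
Local Notation "# x" := (Cst x) (at level 8, x at level 0).
Local Notation "a .@ i" := (Read a i) (at level 9, i at level 8).
Local Notation "x \+ y" := (Add x y) (at level 50, left associativity).
Local Notation "x \- y" := (Defs.Sub x y) (at level 50, left associativity).

Definition mark_sources : cmd :=
  xI ::= #0 ;;
  While ($xNumS \- $xI) (aIsSrc !! aS .@ $xI ::= #1 ;; xI ::= $xI \+ #1).

(* Maxima are computed as [x + (y - x)], with truncated [-]. *)
Definition raise_last (y : nat) : cmd :=
  aLast !! $y ::= aLast .@ $y \+ ($xTime \- aLast .@ $y).

Definition link_edge : cmd :=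
  aNext !! $xI ::= aHead .@ $xTime ;; aHead !! $xTime ::= $xI \+ #1.

Definition index_step : cmd :=
  (xTime ::= aTime .@ $xI ;; xU ::= aU .@ $xI ;; xV ::= aV .@ $xI) ;;
  link_edge ;; raise_last xU ;; raise_last xV ;;
  xMaxTime ::= $xMaxTime \+ ($xTime \- $xMaxTime) ;;
  xI ::= $xI \+ #1.

Definition index_edges : cmd := xI ::= #0 ;; While ($xNumTs \- $xI) index_step.

(* The time-edges of time t form a linked list whose head is cell t of [aHead];
   links are indices shifted by one, and 0 ends a list. *)
Definition for_links (c : cmd) : cmd :=
  xLink ::= aHead .@ $xTime ;;
  While ($xLink) (xI ::= $xLink \- #1 ;; c ;; xLink ::= aNext .@ $xI).

Definition insert : cmd :=
  If (aSeen .@ $xU) Skip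
    (aSeen !! $xU ::= #1 ;;
     aBag !! $xBag \+ $xSize ::= $xU ;;
     aPow !! $xSize \+ #1 ::=
       aPow .@ $xSize \+ (aPow .@ $xSize \+ aPow .@ $xSize) ;;
     xSize ::= $xSize \+ #1).

Definition collect : cmd :=
  for_links (xU ::= aU .@ $xI ;; insert ;; xU ::= aV .@ $xI ;; insert).

Definition layout_step : cmd :=
  (xU ::= aBag .@ ($xBag \+ $xI) ;; aOld !! $xU ::= aNew .@ $xU) ;;
  If (aLast .@ $xU \- $xTime)
    (aNew !! $xU ::= aPow .@ $xNextSize ;;
     aBag !! $xBag \+ $xSize \+ $xNextSize ::= $xU ;;
     xNextSize ::= $xNextSize \+ #1)
    (aNew !! $xU ::= #0) ;;
  xI ::= $xI \+ #1.

Definition layout : cmd :=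
  (xI ::= #0 ;; xNextSize ::= #0) ;; While ($xSize \- $xI) layout_step.

Definition peel : cmd :=
  If ($xRem \+ #1 \- aPow .@ $xI)
    (xRem ::= $xRem \- aPow .@ $xI ;; xDigit ::= $xDigit \+ #1) Skip.

Definition extract_digit : cmd := xDigit ::= #0 ;; peel ;; peel.

Definition penalize : cmd :=
  If ($xDigit \- #1)
    (If (aOld .@ $xU \+ aIsSrc .@ $xU) Skip (xCharge ::= $xK \+ #1))
    (If (aIsSrc .@ $xU) (xCharge ::= $xK \+ #1) Skip).

Definition place_digit : cmd :=
  aDigit !! $xU ::= $xDigit ;;
  If ($xDigit) (xDst ::= $xDst \+ aNew .@ $xU) Skip ;;
  If ($xDigit \- #1) (xSrc ::= $xSrc \+ aOld .@ $xU)
    (xFresh ::= $xFresh \+ $xDigit).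

Definition previous_vertex : cmd :=
  xI ::= $xI \- #1 ;; xU ::= aBag .@ ($xBag \+ $xI).

Definition decode_step : cmd :=
  previous_vertex ;; extract_digit ;; place_digit ;; penalize.

Definition decode : cmd :=
  (xRem ::= $xCode ;; xI ::= $xSize ;; xSrc ::= $xTab ;; xDst ::= $xNextTab ;;
   xFresh ::= #0 ;; xCharge ::= #0) ;;
  While ($xI) decode_step.

Definition add_crossings : cmd :=
  for_links
    (xU ::= aDigit .@ (aU .@ $xI) ;; xV ::= aDigit .@ (aV .@ $xI) ;;
     xCharge ::= $xCharge \+ (($xU \- $xV \- #1) \+ ($xV \- $xU \- #1))).

Definition relax_step : cmd :=
  xV ::= $xDst \+ $xFresh \+ $xR ;;
  aTab !! $xV ::=
    aTab .@ $xV \+ (aTab .@ ($xSrc \+ $xR) \- $xCharge \- aTab .@ $xV) ;;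
  xR ::= $xR \+ #1.

Definition relax : cmd :=
  xR ::= #0 ;; While ($xH \+ #1 \- $xFresh \- $xR) relax_step.

Definition pass : cmd := decode ;; add_crossings ;; relax.

(* The codes of the phases are the multiples of the unit, cell 0 of [aPow],
   below cell [xSize] of [aPow].  Each table and each bag is written to fresh,
   hence zero, cells: this is why no clearing is needed. *)
Definition sweep : cmd :=
  (xNextTab ::= $xTab \+ aPow .@ $xSize ;; xCode ::= #0) ;;
  While (aPow .@ $xSize \- $xCode) (pass ;; xCode ::= $xCode \+ aPow .@ #0).

Definition advance : cmd :=
  xTab ::= $xNextTab ;; xBag ::= $xBag \+ $xSize ;; xSize ::= $xNextSize.

Definition step : cmd :=
  xTime ::= $xTime \+ #1 ;; (collect ;; layout) ;; sweep ;; advance.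

Definition init_table : cmd :=
  xTime ::= #0 ;; aPow !! #0 ::= $xH \+ #1 ;; aTab !! $xNumS ::= $xK \+ #1.

Definition sum_table : cmd :=
  (xR ::= #0 ;; xResult ::= #0) ;;
  While ($xH \+ #1 \- $xR)
    (xResult ::= $xResult \+ aTab .@ ($xTab \+ $xR) ;; xR ::= $xR \+ #1).

Definition solve : cmd :=
  mark_sources ;; index_edges ;;
  (init_table ;; While ($xMaxTime \- $xTime) step) ;; sum_table.

Definition program : cmd :=
  If ($xNumS \- $xH) (xResult ::= #0)
    (If ($xNumS) (If ($xNumTs) solve (xResult ::= #1)) (xResult ::= #1)).

(** * Correctness and running time of the program *)

Lemma effect_peel a p r s : r < p -> vars s xRem = a * p + r ->
  arrs s aPow (vars s xI) = p ->
  vars (effect peel s) xRem = a.-1 * p + r /\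
  vars (effect peel s) xDigit = vars s xDigit + (0 < a).
Proof.
move=> lt_rp s_rem s_pow; rewrite /= s_rem s_pow.
case: a s_rem => [|a] s_rem; first by rewrite ifT ?s_rem ?addn0 //; lia.
rewrite ifN ?mulSn; last by lia.
by rewrite /= /upd /=; split=> //; lia.
Qed.

Lemma effect_extract_digit a p r s : r < p -> a < 3 ->
  vars s xRem = a * p + r -> arrs s aPow (vars s xI) = p ->
  vars (effect extract_digit s) xRem = r /\
  vars (effect extract_digit s) xDigit = a.
Proof.
move=> lt_rp a_lt3 s_rem s_pow; rewrite !effect_seq.
set s0 := effect (xDigit ::= #0) s; have [fv fa] := @effect_frame peel s0 isT.
have [rem1 digit1] := @effect_peel a p r s0 lt_rp s_rem s_pow.
have [|-> ->] := @effect_peel a.-1 p r (effect peel s0) lt_rp rem1.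
  by rewrite fv // fa.
by rewrite digit1; case: a a_lt3 {s_rem rem1 digit1} => [|[|[|]]].
Qed.

Section Program.
Variables (k h : nat) (ss : seq nat) (ts : seq (nat * nat * nat)).

Let edge (i : nat) := nth (0, 0, 0) ts i.

Fixpoint bucket (t i : nat) : seq nat :=
  if i is j.+1 then if (edge j).2 == t then j :: bucket t j else bucket t j
  else [::].

Definition head_link (l : seq nat) : nat := if l is j :: _ then j.+1 else 0.

Lemma bucket_drop t i j : j < size (bucket t i) ->
  let b := nth 0 (bucket t i) j in
  [/\ head_link (drop j (bucket t i)) = b.+1, b < i, (edge b).2 = t
    & bucket t b = drop j.+1 (bucket t i)].
Proof.
elim: i j => // i IHi j /=; case: eqP => [et|_] /= lt_j; last first.
  by have [? ? ? ?] := IHi j lt_j; split=> //; apply: ltnW.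
case: j lt_j => [|j] lt_j; first by rewrite /= drop0.
by have [? ? ? ?] := IHi j lt_j; split=> //; apply: ltnW.
Qed.

Lemma map_edge_bucket t :
  map edge (bucket t (size ts)) = rev [seq x <- ts | x.2 == t].
Proof.
suff edge_take i : i <= size ts ->
    map edge (bucket t i) = rev [seq x <- take i ts | x.2 == t].
  by rewrite edge_take // take_size.
elim: i => [|i IHi] i_le /=; first by rewrite take0.
rewrite (take_nth (0, 0, 0)) // filter_rcons -/(edge i).
by case: ifP => _; rewrite ?rev_rcons /= IHi // ltnW.
Qed.

Lemma run_mark_sources s : vars s xNumS = size ss ->
  arrs s aS = nth 0 ss -> arrs s aIsSrc = (fun=> 0) ->
  run mark_sources s (20 * (size ss).+1)
    (fun s' => arrs s' aIsSrc = (fun u => u \in ss : nat)).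
Proof.
move=> num_s arr_s no_src.
pose I j s' := vars s' xI = j /\ forall u, arrs s' aIsSrc u = (u \in take j ss).
apply: (@run_for_straight I (size ss)) => //.
- by split=> //= u; rewrite no_src take0.
- move=> j s' lt_j [fv fa] [i_j src_j]; split.
    by rewrite /= fv // num_s i_j subn_eq0 -ltnNge.
  split; first by rewrite /= /upd /= i_j addn1.
  move=> u; rewrite /= /upd /= fa // arr_s i_j.
  rewrite (take_nth 0) // mem_rcons inE src_j.
  by case: eqP.
- move=> s' [fv fa] [i_j src_j]; rewrite /= fv // num_s i_j subnn; split=> //.
  by apply: functional_extensionality => u; rewrite src_j take_size.
- by rewrite /=; lia.
Qed.

Definition indexed (j : nat) (s : state) : Prop :=
  [/\ forall t, arrs s aHead t = head_link (bucket t j),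
      forall i, i < j -> arrs s aNext i = head_link (bucket (edge i).2 i),
      forall u, arrs s aLast u = last_time (take j ts) u
    & vars s xMaxTime = max_time (take j ts)].

Definition edges_loaded (s : state) : Prop :=
  arrs s aU = (fun i => (edge i).1.1) /\ arrs s aV = (fun i => (edge i).1.2).

Lemma indexed_step j s : j < size ts -> edges_loaded s ->
  arrs s aTime = (fun i => (edge i).2) -> vars s xI = j ->
  indexed j s -> indexed j.+1 (effect index_step s).
Proof.
move=> lt_j [arr_u arr_v] arr_t i_j [head_j next_j last_j max_j].
split=> [t|i|u|]; rewrite /= /upd /= i_j arr_t ?arr_u ?arr_v.
- by rewrite addn1 eq_sym; case: eqP.
- by rewrite ltnS leq_eqVlt; case: eqP => [-> _|_ /= /next_j->];
    rewrite ?head_j.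
- rewrite (take_nth (0, 0, 0)) // -/(edge j) /last_time big_rcons /= !inE.
  rewrite -/(last_time _ u) -last_j; case: (u =P (edge j).1.2) => [->|_].
    by rewrite orbT; case: eqP => [<-|_]; lia.
  by rewrite orbF; case: (u =P (edge j).1.1) => [<-|_]; lia.
- rewrite max_j (take_nth (0, 0, 0)) // -/(edge j).
  by rewrite /max_time big_rcons /= maxnE.
Qed.

Lemma run_index_edges s : vars s xNumTs = size ts -> vars s xMaxTime = 0 ->
  edges_loaded s -> arrs s aTime = (fun i => (edge i).2) ->
  arrs s aHead = (fun=> 0) -> arrs s aLast = (fun=> 0) ->
  run index_edges s (100 * (size ts).+1) (indexed (size ts)).
Proof.
move=> num_t max0 [arr_u arr_v] arr_t head0 last0.
pose I j s' := vars s' xI = j /\ indexed j s'.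
apply: (@run_for_straight I (size ts)) => //.
- split=> //; split=> //= [t|u|]; first by rewrite head0.
    by rewrite last0 take0 /last_time big_nil.
  by rewrite /upd /= max0 take0 /max_time big_nil.
- move=> j s' lt_j [fv fa] [i_j ind_j]; split.
    by rewrite /= fv // num_t i_j subn_eq0 -ltnNge.
  split; first by rewrite /= /upd /= i_j addn1.
  by apply: indexed_step => //; [split|]; rewrite fa.
- by move=> s' [fv _] [i_j ind]; rewrite /= fv // num_t i_j subnn.
- by rewrite /=; lia.
Qed.

Definition graph_loaded (s : state) : Prop :=
  [/\ vars s xK = k /\ vars s xH = h, edges_loaded s,
      forall t, arrs s aHead t = head_link (bucket t (size ts)),
      forall i, i < size ts -> arrs s aNext i = head_link (bucket (edge i).2 i)
    & (forall u, arrs s aLast u = last_time ts u) /\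
      forall u, arrs s aIsSrc u = (u \in ss)].

Definition keeps_graph : cmd -> bool :=
  keeps [:: xK; xH] [:: aU; aV; aHead; aNext; aLast; aIsSrc].

Lemma graph_loaded_frame c s s' : frame c s s' -> keeps_graph c ->
  graph_loaded s -> graph_loaded s'.
Proof.
move=> fr /(frame_keeps fr)[fv fa].
move=> [[s_k s_h] [s_u s_v] s_head s_next [s_last s_src]].
by split; rewrite /edges_loaded ?fv ?fa.
Qed.

(* The frame condition says that [I] does not depend on the cells [xI] and
   [xLink]. *)
Lemma run_for_links c t s t' (I : seq (nat * nat * nat) -> state -> Prop)
    (Q : state -> Prop) :
  let xs := rev [seq x <- ts | x.2 == t] in
  straight c -> xI \notin mod_vars c -> keeps_graph c ->
  graph_loaded s -> vars s xTime = t ->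
  (forall l s1 s2, frame (xI ::= #0 ;; xLink ::= #0) s1 s2 ->
     I l s1 -> I l s2) ->
  I [::] s ->
  (forall l x s', x \in ts -> x.2 = t ->
     arrs s' aU (vars s' xI) = x.1.1 -> arrs s' aV (vars s' xI) = x.1.2 ->
     graph_loaded s' -> I l s' -> I (rcons l x) (effect c s')) ->
  (forall s', I xs s' -> Q s') ->
  (size xs).+1 * (max_cost c + 20) <= t' ->
  run (for_links c) s t' Q.
Proof.
move=> xs str_c keep_i keep_g loaded s_t I_frame I0 I_step IQ t_le.
set b := bucket t (size ts).
have xsE : map edge b = xs by apply: map_edge_bucket.
have size_b : size b = size xs by rewrite -xsE size_map.
pose J j s' := [/\ vars s' xLink = head_link (drop j b), graph_loaded s'
  & I (take j xs) s'].
apply: (@run_for_straight J (size b)) => //; rewrite /= ?str_c //.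
- split; last by rewrite take0; apply: I_frame I0; apply: frame_assign.
    by have [_ _ s_head _ _] := loaded; rewrite /= /upd /= s_t s_head drop0.
  by apply: (@graph_loaded_frame (xLink ::= #0)) loaded;
    first apply: frame_assign.
- move=> j s' lt_j _ [link_j loaded_j I_j].
  have [link_i i_lt i_t next_i] := bucket_drop lt_j.
  set i := nth 0 _ j in link_i i_lt i_t next_i.
  rewrite link_j link_i; split=> //.
  set s1 := State (upd (vars s') _ _) _.
  have s1_i : vars s1 xI = i by rewrite /= /upd /= ?link_j ?link_i subn1.
  have loaded1 : graph_loaded s1.
    by apply: (@graph_loaded_frame (xI ::= #0)) loaded_j;
      first apply: frame_assign.
  have fr2 := effect_frame s1 str_c.
  have loaded2 := graph_loaded_frame fr2 keep_g loaded1.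
  have [_ [s1_u s1_v] _ _ _] := loaded1; have [_ _ _ s2_next _] := loaded2.
  have edge_i : edge i = nth (0, 0, 0) xs j by rewrite -xsE (nth_map 0).
  split.
  + by rewrite /= /upd /= fr2.1 // s1_i s2_next // i_t next_i.
  + by apply: (@graph_loaded_frame (xLink ::= #0)) loaded2;
      first apply: frame_assign.
  rewrite (take_nth (0, 0, 0)) -?size_b // -edge_i.
  apply: (I_frame _ (effect c s1)); first exact: frame_assign.
  apply: I_step => //; rewrite ?s1_i ?s1_u ?s1_v //; first exact: mem_nth.
  by apply: I_frame I_j; apply: frame_assign.
- by move=> s' _ [-> _]; rewrite size_b take_size -size_b drop_size => /IQ.
- by rewrite size_b; lia.
Qed.

Definition bag_loaded (B : seq nat) (s : state) : Prop :=
  [/\ vars s xSize = size B,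
      forall i, i < size B -> arrs s aBag (vars s xBag + i) = nth 0 B i
    & forall i, i <= size B -> arrs s aPow i = h.+1 * 3 ^ i].

Lemma bag_loaded_frame c s s' B : frame c s s' ->
  keeps [:: xSize; xBag] [:: aBag; aPow] c -> bag_loaded B s -> bag_loaded B s'.
Proof.
move=> fr /(frame_keeps fr)[fv fa] [s_size s_bag s_pow].
by split; rewrite ?fv ?fa.
Qed.

Definition seen_marked (t : nat) (s : state) : Prop :=
  forall u, (arrs s aSeen u != 0) = seen ts t u.

Definition new_weights (l : seq nat) (s : state) : Prop :=
  forall u, arrs s aNew u = weight 3 h.+1 l u.

Definition collected (t : nat) (K : seq nat) (A : pred nat)
    (s : state) : Prop :=
  exists B, [/\ uniq B, bag_loaded B s, forall u, (u \in B) = (u \in K) || A u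
    & forall u, (arrs s aSeen u != 0) = seen ts t u || A u].

Lemma collected_frame c s s' t K A : frame c s s' ->
  keeps [:: xSize; xBag] [:: aBag; aPow; aSeen] c ->
  collected t K A s -> collected t K A s'.
Proof.
move=> fr keep [B [UB B_load B_mem seenE]]; have [_ fa] := frame_keeps fr keep.
exists B; split=> //; last by move=> u; rewrite fa ?seenE ?inE ?orbT.
apply: bag_loaded_frame fr _ B_load; move: keep.
by rewrite /keeps /= !andbT -!andbA => /and5P[-> -> -> ->].
Qed.

Lemma bag_loaded_rcons B s : bag_loaded B s -> arrs s aSeen (vars s xU) = 0 ->
  bag_loaded (rcons B (vars s xU)) (effect insert s).
Proof.
move=> [s_size s_bag s_pow] /= ->.
split; rewrite /= /upd /= ?size_rcons ?s_size ?addn1 //.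
- move=> i i_le; rewrite nth_rcons eqn_add2l.
  by case: (ltngtP i (size B)) i_le => [/s_bag||] // ? ?; lia.
- move=> i i_le; case: eqP => [->|ne]; first by rewrite s_pow // expnS; lia.
  by rewrite s_pow //; lia.
Qed.

Lemma collected_insert t K A s :
  seen ts t (vars s xU) = (vars s xU \in K) -> collected t K A s ->
  collected t K (fun u => A u || (u == vars s xU)) (effect insert s).
Proof.
move=> seenK [B [UB B_load B_mem seenE]]; set v := vars s xU in seenK *.
have memB : (v \in B) = (arrs s aSeen v != 0) by rewrite B_mem seenE seenK.
have [new|old] := eqVneq (arrs s aSeen v) 0.
  exists (rcons B v); split.
  - by rewrite rcons_uniq UB memB new.
  - exact: bag_loaded_rcons.
  - by move=> u; rewrite mem_rcons inE B_mem orbC orbA.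
  - move=> u; rewrite /= new /= /upd /= orbA -seenE.
    by case: (u =P v); rewrite ?orbT ?orbF.
exists B; rewrite /= -/v (negbTE old).
split=> // u; rewrite orbA -?B_mem -?seenE.
  by have [->|_] := eqVneq u v; rewrite ?orbF // memB old.
by have [->|_] := eqVneq u v; rewrite ?orbF // old.
Qed.

Lemma collected_step t K xs x s : lists K (alive ts t) ->
  x \in ts -> x.2 = t.+1 ->
  arrs s aU (vars s xI) = x.1.1 -> arrs s aV (vars s xI) = x.1.2 ->
  collected t K (touched xs) s ->
  collected t K (touched (rcons xs x))
    (effect (xU ::= aU .@ $xI ;; insert ;; xU ::= aV .@ $xI ;; insert) s).
Proof.
move=> K_list xts x_t s_u s_v s_coll; rewrite !effect_seq.
have seenK u : u \in ends x -> seen ts t u = (u \in K).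
  move=> /(active_end xts)/andP[_ last_u].
  by rewrite K_list.2 /alive -x_t last_u andbT.
set s1 := effect (xU ::= aU .@ $xI) s; set s2 := effect insert s1.
set s3 := effect (xU ::= aV .@ $xI) s2.
have s1_u : vars s1 xU = x.1.1 by [].
have s3_u : vars s3 xU = x.1.2.
  by have [fv fa] := @effect_frame insert s1 isT; rewrite /= /upd /= fa // fv.
have coll1 : collected t K (touched xs) s1.
  have fr1 := @effect_frame (xU ::= aU .@ $xI) s isT.
  exact: collected_frame fr1 isT s_coll.
have := collected_insert _ coll1.
rewrite s1_u seenK ?mem_head // => /(_ erefl) coll2.
have coll3 : collected t K (fun u => touched xs u || (u == x.1.1)) s3.
  have fr3 := @effect_frame (xU ::= aV .@ $xI) s2 isT.
  exact: collected_frame fr3 isT coll2.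
have := collected_insert _ coll3.
rewrite s3_u seenK ?inE ?eqxx ?orbT // => /(_ erefl).
case=> B [UB B_load B_mem seenE].
by exists B; split=> // u; rewrite touched_rcons.
Qed.

Lemma run_collect t K s : graph_loaded s -> vars s xTime = t.+1 ->
  lists K (alive ts t) -> bag_loaded K s ->
  seen_marked t s ->
  run collect s (100 * (count (fun x => x.2 == t.+1) ts).+1)
    (fun s' => exists B, [/\ lists B (active ts t.+1), bag_loaded B s'
       & seen_marked t.+1 s']).
Proof.
move=> loaded s_t K_list K_load s_seen.
apply: (@run_for_links _ t.+1 _ _ (fun xs => collected t K (touched xs))) => //.
- by move=> xs s1 s2 fr; apply: collected_frame fr _.
- by exists K; split; rewrite ?K_list.1 // => u; rewrite ?orbF.
- by move=> xs x s' xts x_t s_u s_v _; apply: collected_step.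
- move=> s' [B [UB B_load B_mem seenE]].
  have touchedE u := has_rev (fun x => u \in ends x).
  exists B; split=> // [|u]; last by rewrite seenS seenE /touched touchedE.
  by split=> // u; rewrite activeS B_mem K_list.2 /touched touchedE.
- by rewrite size_rev size_filter /=; lia.
Qed.

Definition next_bag (t : nat) (l : seq nat) : seq nat :=
  [seq u <- l | t < last_time ts u].

Lemma lists_next_bag t B :
  lists B (active ts t) -> lists (next_bag t B) (alive ts t).
Proof.
case=> UB B_mem; split; first exact: filter_uniq.
move=> u; rewrite mem_filter B_mem andbCA; congr (_ && _).
by rewrite andb_idr // => /ltnW.
Qed.

Definition laid_out (t : nat) (K B l : seq nat) (s : state) : Prop :=
  let N := next_bag t l in
  [/\ vars s xNextSize = size N, bag_loaded B s,
      forall i, i < size N ->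
        arrs s aBag (vars s xBag + size B + i) = nth 0 N i,
      {in l, forall u, arrs s aOld u = weight 3 h.+1 K u}
    & forall u, arrs s aNew u =
        if u \in l then weight 3 h.+1 N u else weight 3 h.+1 K u].

Lemma laid_out_step t K B j s : uniq B -> j < size B -> graph_loaded s ->
  vars s xTime = t -> vars s xI = j ->
  laid_out t K B (take j B) s ->
  laid_out t K B (take j.+1 B) (effect layout_step s).
Proof.
move=> UB lt_j [_ _ _ _ [s_last _]] s_t s_j.
move=> [s_next [s_size s_bag s_pow] s_nbag s_old s_new].
have := take_uniq j.+1 UB; rewrite (take_nth 0) // rcons_uniq.
set l := take j B in s_next s_nbag s_old s_new *.
set u := nth 0 B j => /andP[ul _].
have u_new : arrs s aNew u = weight 3 h.+1 K u by rewrite s_new (negbTE ul).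
have uN : u \notin next_bag t l by rewrite mem_filter (negbTE ul) andbF.
have size_N : size (next_bag t l) <= size B.
  by rewrite size_filter (leq_trans (count_size _ _)) // size_take_min geq_minr.
have oldS : {in rcons l u, forall v,
    (if v == u then arrs s aNew u else arrs s aOld v) = weight 3 h.+1 K v}.
  move=> v; rewrite mem_rcons inE.
  by have [-> //|_] := eqVneq v u; apply: s_old.
rewrite /laid_out [next_bag t (rcons l u)]filter_rcons -/(next_bag t l).
rewrite /= /upd /= s_j s_bag //= -/u s_last s_t subn_eq0 ltnNge.
case: leqP => [_|u_late] /=; split=> //.
- move=> v; rewrite mem_rcons inE; have [->|_] := eqVneq v u; last exact: s_new.
  by rewrite /weight (negbTE uN).
- by rewrite size_rcons s_next addn1.
- split=> // i lt_i; rewrite /= ifN ?s_bag //.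
  by rewrite -addnA eqn_add2l s_size; lia.
- move=> i; rewrite s_size s_next size_rcons eqn_add2l nth_rcons ltnS.
  by case: (ltngtP i) => // lt_i _; apply: s_nbag.
- move=> v; rewrite mem_rcons inE weight_rcons //; have [->|_] := eqVneq v u.
    by rewrite s_next s_pow.
  exact: s_new.
Qed.

Lemma run_layout t K B s : graph_loaded s -> vars s xTime = t ->
  uniq B -> bag_loaded B s ->
  new_weights K s ->
  run layout s (100 * (size B).+1) (laid_out t K B B).
Proof.
move=> loaded s_t UB B_load s_new.
pose I j s' := vars s' xI = j /\ laid_out t K B (take j B) s'.
apply: (@run_for_straight I (size B)) => //.
- split=> //; rewrite take0; split=> //.
- move=> j s' lt_j fr [i_j laid]; have [s_size _ _] := B_load.
  split; first by rewrite /= fr.1 // s_size i_j subn_eq0 -ltnNge.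
  split; first by rewrite /= /upd; case: ifP => _ /=; rewrite /upd /= i_j addn1.
  apply: laid_out_step => //; last by rewrite fr.1.
  exact: graph_loaded_frame fr _ loaded.
- move=> s' fr [i_j]; rewrite take_size => laid; split=> //.
  by have [_ [s_size _ _] _ _ _] := laid; rewrite /= s_size i_j subnn.
- by rewrite /=; lia.
Qed.

Lemma laid_out_new t K B s : lists K (alive ts t) -> lists B (active ts t.+1) ->
  laid_out t.+1 K B B s ->
  new_weights (next_bag t.+1 B) s.
Proof.
move=> K_list B_list [_ _ _ _ s_new] u; rewrite s_new; case: ifPn => // uB.
rewrite /weight mem_filter (negbTE uB) andbF ifN //; apply: contra uB => uK.
exact: subset_alive_active K_list B_list _ uK.
Qed.

Definition relaxed_by (T T' : nat -> nat) (source target skipped cost : nat)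
    : Prop :=
  forall i, T' i = if target + skipped <= i <= target + h
    then maxn (T i) (T (source + (i - (target + skipped))) - cost) else T i.

Lemma run_relax s : vars s xH = h -> vars s xSrc + h < vars s xDst ->
  run relax s (100 * h.+2) (fun s' => relaxed_by (arrs s aTab) (arrs s' aTab)
    (vars s xSrc) (vars s xDst) (vars s xFresh) (vars s xCharge)).
Proof.
set T := arrs s aTab; set source := vars s xSrc; set target := vars s xDst.
set skipped := vars s xFresh; set cost := vars s xCharge => s_h lt_st.
pose I j s' := vars s' xR = j /\ forall i, arrs s' aTab i =
  if target + skipped <= i < target + skipped + j
  then maxn (T i) (T (source + (i - (target + skipped))) - cost) else T i.
apply: (@run_for_straight I (h.+1 - skipped)) => //.
- split=> // i; rewrite /= addn0.
  by case: leqP => //= le_i; rewrite ltnNge le_i.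
- move=> j s' lt_j [fv _] [r_j tab_j]; split.
    by rewrite /= r_j !fv // s_h -/skipped; lia.
  split=> [|i]; rewrite /= /upd /= r_j ?addn1 // !fv // !tab_j.
  rewrite -/source -/target -/skipped -/cost.
  rewrite (_ : (_ <= source + j) && _ = false); last by lia.
  rewrite (_ : (_ <= target + skipped + j) && _ = false); last by lia.
  case: (i =P target + skipped + j) => [->|ne].
    by rewrite (_ : (_ <= _) && _ = true) ?addKn; lia.
  have -> : (i < target + skipped + j.+1) = (i < target + skipped + j) by lia.
  by [].
- move=> s' [fv _] [r_j tab_j]; split.
    by rewrite /= r_j !fv // s_h -/skipped; lia.
  by move=> i; rewrite tab_j; congr (if _ then _ else _); lia.
- by rewrite /=; lia.
Qed.

Section Pass.
Variables (t : nat) (K B N : seq nat).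
Hypotheses (K_list : lists K (alive ts t)) (B_list : lists B (active ts t.+1))
  (N_list : lists N (alive ts t.+1)).

Definition ready (s : state) : Prop :=
  [/\ graph_loaded s, vars s xTime = t.+1, bag_loaded B s,
      {in B, forall u, arrs s aOld u = weight 3 h.+1 K u}
    & new_weights N s].

Definition keeps_ready (c : cmd) : bool :=
  [&& keeps_graph c, keeps [:: xSize; xBag] [:: aBag; aPow] c
    & keeps [:: xTime] [:: aOld; aNew] c].

Lemma ready_frame c s s' : frame c s s' -> keeps_ready c -> ready s -> ready s'.
Proof.
move=> fr /and3P[keep_g keep_b /(frame_keeps fr)[fv fa]].
move=> [loaded s_t B_load s_old s_new].
split; rewrite /new_weights ?fv ?fa //.
  exact: graph_loaded_frame fr _ loaded.
exact: bag_loaded_frame fr _ B_load.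
Qed.

Definition decoded (d : nat -> nat) (l : seq nat) (off off' : nat)
    (s : state) : Prop :=
  [/\ {in l, forall u, arrs s aDigit u = d u},
      vars s xSrc = off + \sum_(u <- l | d u == 2) weight 3 h.+1 K u,
      vars s xDst = off' + \sum_(u <- l | 0 < d u) weight 3 h.+1 N u
    & vars s xFresh = fresh l d].

Lemma effect_penalize d s u : ready s -> u \in B -> vars s xU = u ->
  vars s xDigit = d u -> d u < 3 ->
  vars (effect penalize s) xCharge =
    if misplaced ss K d u then k.+1 else vars s xCharge.
Proof.
move=> [[[s_k _] _ _ _ [_ s_src]] _ _ s_old _] uB s_u s_digit d_lt3.
have placed :
    (weight 3 h.+1 K u + (u \in ss) == 0) = (u \notin K) && (u \notin ss).
  rewrite addn_eq0 eqb0 /weight; case: ifP => // _.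
  by rewrite muln_eq0 expn_eq0.
rewrite /misplaced /= s_u s_digit s_old // s_src placed s_k addn1.
case: (d u) d_lt3 => [|[|[|]]] //= _; rewrite ?eqb0; first by case: (u \in ss).
  by case: (u \in ss).
by case: (_ && _).
Qed.

Lemma decoded_place d l off off' s u : ready s -> u \in B -> vars s xU = u ->
  vars s xDigit = d u -> d u < 3 -> decoded d l off off' s ->
  decoded d (u :: l) off off' (effect place_digit s).
Proof.
move=> [_ _ _ s_old s_new] uB s_u s_digit d_lt3 [digits srcE dstE freshE].
have digitsS : {in u :: l, forall v,
    (if v == u then d u else arrs s aDigit v) = d v}.
  by move=> v; rewrite inE; have [-> //|_] := eqVneq v u; apply: digits.
rewrite /decoded !big_cons /fresh /= -/(fresh l d) /upd /= s_u s_digit.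
case du: (d u) d_lt3 digitsS => [|[|[|]]] //= _ digitsS;
  rewrite s_digit du /= ?s_u ?s_old ?s_new // ?srcE ?dstE ?freshE ?addn0.
- by [].
- by split; rewrite ?addnA ?addn1 // addnAC.
- by split; rewrite ?addnA // addnAC.
Qed.

Definition decoding (q i off off' : nat) (s : state) : Prop :=
  let d := digit 3 B q in
  [/\ vars s xI = i, vars s xRem = h.+1 * (q %% 3 ^ i),
      decoded d (drop i B) off off' s
    & vars s xCharge = penalty ss k K (drop i B) d].

Lemma decoding_step q i off off' s : ready s -> i < size B ->
  decoding q i.+1 off off' s -> decoding q i off off' (effect decode_step s).
Proof.
move=> rdy lt_i [s_i s_rem dec charge].
set u := nth 0 B i; set d := digit 3 B q in dec charge.
have uB : u \in B by apply: mem_nth.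
have d_u : d u = (q %/ 3 ^ i) %% 3 by rewrite /d /digit index_uniq // B_list.1.
have d_lt3 : d u < 3 by apply: ltn_digit.
rewrite /decode_step effect_seq; set s1 := effect previous_vertex s.
have fr1 := @effect_frame previous_vertex s isT; rewrite -/s1 in fr1.
have [s1_i s1_u] : vars s1 xI = i /\ vars s1 xU = u.
  by have [_ _ [_ s_bag _] _ _] := rdy; rewrite /s1 /= /upd /= s_i subn1 s_bag.
have s1_rem : vars s1 xRem = d u * (h.+1 * 3 ^ i) + h.+1 * (q %% 3 ^ i).
  by rewrite fr1.1 // s_rem modn_expS -d_u mulnDr mulnCA.
have rdy1 : ready s1 by apply: ready_frame fr1 _ rdy.
rewrite effect_seq; set s2 := effect extract_digit s1.
have fr2 := @effect_frame extract_digit s1 isT; rewrite -/s2 in fr2.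
have [s2_rem s2_digit] :
    vars s2 xRem = h.+1 * (q %% 3 ^ i) /\ vars s2 xDigit = d u.
  apply: effect_extract_digit s1_rem _;
    rewrite ?ltn_pmul2l ?ltn_mod ?expn_gt0 //.
  by have [_ _ [_ _ s1_pow] _ _] := rdy1; rewrite s1_i s1_pow // ltnW.
have rdy2 : ready s2 by apply: ready_frame fr2 _ rdy1.
have s2_u : vars s2 xU = u by rewrite fr2.1.
have dec2 : decoded d (drop i.+1 B) off off' s2.
  by case: dec => *; split; rewrite ?fr2.1 ?fr2.2 ?fr1.1 ?fr1.2.
rewrite effect_seq; set s3 := effect place_digit s2.
have fr3 := @effect_frame place_digit s2 isT; rewrite -/s3 in fr3.
have rdy3 : ready s3 by apply: ready_frame fr3 _ rdy2.
have dec3 : decoded d (u :: drop i.+1 B) off off' s3.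
  exact: decoded_place rdy2 uB s2_u s2_digit d_lt3 dec2.
have [fv4 fa4] := @effect_frame penalize s3 isT.
rewrite /decoding (drop_nth 0) // -/u -/d; split.
- by rewrite fv4 // fr3.1 // fr2.1.
- by rewrite fv4 // fr3.1.
- by case: dec3 => *; split; rewrite ?fv4 ?fa4.
- rewrite (effect_penalize (d := d) rdy3 uB) ?fr3.1 // fr2.1 // fr1.1 //.
  rewrite charge /penalty /=.
  by case: (misplaced _ _ _ _).
Qed.

Lemma run_decode q s : ready s -> vars s xCode = h.+1 * q -> q < 3 ^ size B ->
  run decode s (300 * (size B).+1) (fun s' =>
    decoded (digit 3 B q) B (vars s xTab) (vars s xNextTab) s' /\
    vars s' xCharge = penalty ss k K B (digit 3 B q)).
Proof.
move=> rdy s_code q_lt.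
pose I j := decoding q (size B - j) (vars s xTab) (vars s xNextTab).
apply: (@run_for_straight I (size B)).
- by [].
- by [].
- have [_ _ [s_size _ _] _ _] := rdy.
  rewrite /I /decoding /decoded subn0 drop_size /= /upd /=.
  rewrite s_size s_code modn_small //.
  by split=> //; split; rewrite // big_nil addn0.
- move=> j s' lt_j fr dec_j; have rdy' := ready_frame fr isT rdy.
  have jE : size B - j = (size B - j.+1).+1 by lia.
  rewrite /I jE in dec_j; have [i_j _ _ _] := dec_j.
  split; first by rewrite /= i_j.
  by apply: decoding_step dec_j => //; lia.
- move=> s' _; rewrite /I subnn => -[i_0 _]; rewrite drop0 => dec charge.
  by split; first exact: i_0.
- by rewrite /=; lia.
Qed.

Lemma run_add_crossings d s :
  ready s -> {in B, forall u, arrs s aDigit u = d u} ->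
  run add_crossings s (100 * (count (fun x => x.2 == t.+1) ts).+1)
    (fun s' => vars s' xCharge =
       vars s xCharge + \sum_(x <- ts | x.2 == t.+1) crossing d x).
Proof.
move=> [loaded s_t _ _ _] digits.
pose I xs s' := arrs s' aDigit = arrs s aDigit /\
  vars s' xCharge = vars s xCharge + \sum_(x <- xs) crossing d x.
apply: (@run_for_links _ t.+1 _ _ I) => //.
- by move=> xs s1 s2 fr [digit1 charge1]; split; rewrite ?fr.1 ?fr.2.
- by split=> //; rewrite big_nil addn0.
- move=> xs x s' xts x_t s_u s_v _ [digit_s charge_s]; split=> //.
  rewrite /= /upd /= s_u s_v digit_s charge_s !digits; try by
    apply: end_mem_active xts x_t _; rewrite // !inE eqxx ?orbT.
  by rewrite big_rcons -addnA.
- move=> s' [_ ->]; congr (_ + _); rewrite -[RHS]big_filter.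
  by apply: perm_big; rewrite perm_rev.
- by rewrite size_rev size_filter /=; lia.
Qed.

Lemma src_lt d : src h K d + h < h.+1 * 3 ^ size B.
Proof.
have : code 3 K (fun u => d u == 2) < 3 ^ size B.
  apply: (@leq_trans (3 ^ size K)).
    by apply: ltn_code => u; case: (_ == _).
  by rewrite leq_pexp2l // (leq_size_alive K_list B_list).
by rewrite /src; nia.
Qed.

Lemma dst_lt d : dst h N d + h < h.+1 * 3 ^ size N.
Proof.
have : code 3 N (fun u => 0 < d u) < 3 ^ size N.
  by apply: ltn_code => u; case: (0 < _).
by rewrite /dst; nia.
Qed.

Lemma run_pass q s : ready s -> vars s xCode = h.+1 * q -> q < 3 ^ size B ->
  vars s xNextTab = vars s xTab + h.+1 * 3 ^ size B ->
  let d := digit 3 B q in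
  run pass s (300 * (size B + count (fun x => x.2 == t.+1) ts + h + 4))
    (fun s' => relaxed_by (arrs s aTab) (arrs s' aTab) (vars s xTab + src h K d)
       (vars s xNextTab + dst h N d) (fresh B d) (charge ss ts k t K B d)).
Proof.
move=> rdy s_code q_lt s_next d.
have srcE : \sum_(u <- B | d u == 2) weight 3 h.+1 K u = src h K d.
  exact: sum_weight K_list.1 B_list.1 (subset_alive_active K_list B_list).
have dstE : \sum_(u <- B | 0 < d u) weight 3 h.+1 N u = dst h N d.
  exact: sum_weight N_list.1 B_list.1 (subset_next_alive_active B_list N_list).
apply: run_leq (run_seq (run_decode rdy s_code q_lt) _) _.
  move=> s1 fr1 [[digits s1_src s1_dst s1_fresh] s1_pen].
  rewrite srcE in s1_src; rewrite dstE in s1_dst.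
  have rdy1 := ready_frame fr1 isT rdy.
  apply: run_seq (run_add_crossings rdy1 digits) _ => s2 fr2 s2_charge.
  have [[[_ s2_h] _ _ _ _] _ _ _ _] := ready_frame fr2 isT rdy1.
  rewrite -s1_src -s1_dst -s1_fresh /charge -s1_pen -s2_charge.
  rewrite -fr1.2 // -!fr2.1 // -fr2.2 //.
  apply: run_relax => //; rewrite !fr2.1 // s1_src s1_dst s_next -addnA.
  by have := src_lt d; lia.
by lia.
Qed.

Definition table_at (T : nat -> nat) (off i : nat) : nat := T (off + i).

Definition swept (T0 : nat -> nat) (off off' j : nat) (T : nat -> nat) : Prop :=
  [/\ forall i, i < off' -> T i = T0 i,
      relax_complete ss ts k h t K B N j (table_at T0 off) (table_at T off')
    & relax_sound ss ts k h t K B N (table_at T0 off) (table_at T off')].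

Lemma sweptS T0 T T' off off' j : let d := digit 3 B j in
  off + (src h K d + h) < off' ->
  relaxed_by T T' (off + src h K d) (off' + dst h N d) (fresh B d)
    (charge ss ts k t K B d) ->
  swept T0 off off' j T -> swept T0 off off' j.+1 T'.
Proof.
move=> d src_lt_off relT [low complT soundT].
rewrite /swept /table_at in complT soundT *.
have relT0 r : r <= h -> T (off + src h K d + r) = T0 (off + (src h K d + r)).
  by move=> r_h; rewrite -addnA low //; move: src_lt_off; lia.
split=> [i lt_i|q r /=|i].
- by rewrite relT ifF ?low //; apply/negbTE; lia.
- rewrite ltnS leq_eqVlt => /predU1P[->|lt_q] r_h; last first.
    apply: leq_trans (complT q r lt_q r_h) _.
    by rewrite relT; case: ifP; rewrite ?leq_maxl.
  rewrite -/d in r_h *; rewrite relT ifT; last by lia.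
  rewrite (_ : _ - (_ + fresh B d) = r); last by lia.
  by rewrite relT0 ?leq_maxr //; lia.
rewrite relT; case: ifP => [/andP[i_ge i_le]|_]; last exact: soundT.
case: (leqP (T (off' + i)) _) => _ T_gt0; last exact: soundT _ T_gt0.
exists j, (off' + i - (off' + dst h N d + fresh B d)); rewrite -/d.
by split; rewrite ?relT0 //; lia.
Qed.

Lemma run_sweep s : ready s ->
  let T0 := arrs s aTab in
  (forall i, vars s xTab + h.+1 * 3 ^ size K <= i -> T0 i = 0) ->
  run sweep s
    (3 ^ size B *
       (300 * (size B + count (fun x => x.2 == t.+1) ts + h + 4) + 20) + 20)
    (fun s' => let off' := vars s xTab + h.+1 * 3 ^ size B in
       [/\ vars s' xNextTab = off',
           swept T0 (vars s xTab) off' (3 ^ size B) (arrs s' aTab)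
         & forall i, off' + h.+1 * 3 ^ size N <= i -> arrs s' aTab i = 0]).
Proof.
move=> rdy T0 T0_out.
set off := vars s xTab; set off' := off + h.+1 * 3 ^ size B.
pose I j s' := [/\ vars s' xCode = h.+1 * j, vars s' xNextTab = off'
  & swept T0 off off' j (arrs s' aTab)].
apply: (@run_for I (3 ^ size B)); first by [].
- have [_ _ [s_size _ s_pow] _ _] := rdy.
  rewrite /I /= /upd /= muln0 s_size s_pow //; split=> //; split=> // i.
  rewrite /table_at -/T0 T0_out // /off' -addnA leq_add2l.
  apply: leq_trans _ (leq_addr _ _).
  by rewrite leq_mul2l /= leq_pexp2l // (leq_size_alive K_list B_list).
- move=> j s' lt_j fr [code_j next_j swept_j].
  have rdy' := ready_frame fr isT rdy; have [_ _ [s_size _ s_pow] _ _] := rdy'.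
  split; first by rewrite /= s_size s_pow // code_j subn_eq0 -ltnNge ltn_pmul2l.
  have tab_j : vars s' xTab = off by rewrite fr.1.
  apply: run_seq (run_pass rdy' code_j lt_j _) _; first by rewrite next_j tab_j.
  rewrite tab_j next_j => s1 fr1 rel1.
  have [_ _ [_ _ s1_pow] _ _] := ready_frame fr1 isT rdy'.
  apply: run_straight => //; split; rewrite /= /upd /= ?fr1.1 //.
    by rewrite code_j s1_pow // expn0 muln1 mulnS addnC.
  by apply: sweptS rel1 swept_j; rewrite /off' ltn_add2l src_lt.
- move=> s' fr [code_j next_j swept_j].
  have [_ _ [s_size _ s_pow] _ _] := ready_frame fr isT rdy.
  split; first by rewrite /= s_size s_pow // code_j subnn.
  split=> // i le_i; have [low _ soundT] := swept_j.
  rewrite (_ : i = off' + (i - off')); last by lia.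
  apply/eqP; rewrite -leqn0 leqNgt; apply/negP => /soundT[q [r [r_h iE _]]].
  by have := dst_lt (digit 3 B q); lia.
- by rewrite /=; lia.
Qed.

End Pass.

Definition processed (t : nat) (s : state) : Prop :=
  [/\ graph_loaded s, vars s xTime = t & exists K, [/\ lists K (alive ts t),
    bag_loaded K s, seen_marked t s, new_weights K s
    & table_correct ss ts k h t K (table_at (arrs s aTab) (vars s xTab)) /\
      (forall i, vars s xTab + h.+1 * 3 ^ size K <= i -> arrs s aTab i = 0)]].

Lemma processed_advance t K B T off s : let N := next_bag t.+1 B in
  let off' := off + h.+1 * 3 ^ size B in
  t < max_time ts -> lists K (alive ts t) -> lists B (active ts t.+1) ->
  table_correct ss ts k h t K (table_at T off) ->
  ready t K B N s -> laid_out t.+1 K B B s ->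
  seen_marked t.+1 s ->
  vars s xNextTab = off' ->
  swept t K B N T off off' (3 ^ size B) (arrs s aTab) ->
  (forall i, off' + h.+1 * 3 ^ size N <= i -> arrs s aTab i = 0) ->
  processed t.+1 (effect advance s).
Proof.
move=> N off' lt_t K_list B_list tabT [loaded s_t [s_size s_bag s_pow] _ s_new].
move=> [s_nsize _ s_nbag _ _] s_seen s_next [_ complT soundT] tab0.
have N_list := lists_next_bag B_list.
split; [exact: graph_loaded_frame (effect_frame _ _) _ loaded | by [] |].
exists N; split; rewrite // /advance /= /upd /=.
- split; rewrite /= ?s_size // => i i_le; apply: s_pow; apply: leq_trans i_le _.
  exact: leq_size_next_alive B_list N_list.
- rewrite s_next; split=> //.
  exact: (table_correctS K_list B_list N_list lt_t tabT soundT complT).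
Qed.

Lemma run_collect_layout t K s w e :
  count (active ts t.+1) (verts ts) <= w ->
  count (fun x => x.2 == t.+1) ts <= e ->
  graph_loaded s -> vars s xTime = t.+1 ->
  lists K (alive ts t) -> bag_loaded K s ->
  seen_marked t s ->
  new_weights K s ->
  run (collect ;; layout) s (100 * e.+1 + 100 * w.+1) (fun s' =>
    exists B, [/\ lists B (active ts t.+1), ready t K B (next_bag t.+1 B) s',
      laid_out t.+1 K B B s'
      & seen_marked t.+1 s']).
Proof.
move=> w_le e_le loaded s_t K_list K_load s_seen s_new.
apply: run_seq (run_leq (run_collect loaded s_t K_list K_load s_seen) _) _.
  by rewrite leq_mul2l /= ltnS e_le.
move=> s1 fr1 [B [B_list B_load s1_seen]].
have loaded1 := graph_loaded_frame fr1 isT loaded.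
have s1_t : vars s1 xTime = t.+1 by rewrite fr1.1.
apply: run_weaken (run_layout loaded1 s1_t B_list.1 B_load _) _ _.
- by move=> u; rewrite fr1.2 // s_new.
- by rewrite leq_mul2l /= ltnS (size_lists_active B_list).
move=> s2 fr2 laid2; have [_ B_load2 _ s2_old _] := laid2.
exists B; split=> //; last by move=> u; rewrite fr2.2.
split; rewrite ?fr2.1 //; first exact: graph_loaded_frame fr2 isT loaded1.
exact: laid_out_new K_list B_list laid2.
Qed.

Lemma run_step t s w e : t < max_time ts ->
  count (active ts t.+1) (verts ts) <= w ->
  count (fun x => x.2 == t.+1) ts <= e ->
  processed t s ->
  run step s (3 ^ w * (700 * (w + e + h + 4))) (processed t.+1).
Proof.
move=> lt_t w_le e_le [loaded s_t [K [K_list K_load s_seen s_new [tabK tab0]]]].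
have run_tick :
    run (xTime ::= $xTime \+ #1) s 4 (fun s' => vars s' xTime = t.+1).
  by apply: run_straight => //; rewrite /= /upd /= s_t addn1.
apply: run_leq (run_seq run_tick _) _.
  move=> s1 fr1 s1_t.
  apply: run_seq (run_collect_layout w_le e_le _ s1_t K_list _ _ _) _.
  - exact: graph_loaded_frame fr1 isT loaded.
  - exact: bag_loaded_frame fr1 isT K_load.
  - by move=> u; rewrite fr1.2 // s_seen.
  - by move=> u; rewrite fr1.2 // s_new.
  move=> s2 fr2 [B [B_list rdy2 laid2 s2_seen]].
  have B_le : size B <= w by rewrite (size_lists_active B_list).
  have N_list := lists_next_bag B_list.
  have tab2 : arrs s2 aTab = arrs s aTab by rewrite fr2.2 // fr1.2.
  have off2 : vars s2 xTab = vars s xTab by rewrite fr2.1 // fr1.1.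
  apply: run_seq (run_leq (t' := 3 ^ w * (300 * (w + e + h + 4) + 20) + 20)
                    (run_sweep K_list B_list N_list rdy2 _) _) _.
  - by rewrite tab2 off2.
  - rewrite leq_add2r leq_mul ?leq_pexp2l // leq_add2r leq_mul2l /=.
    by rewrite !leq_add2r leq_add.
  rewrite tab2 off2 => s3 fr3 [s3_next swept3 s3_tab0].
  apply: run_straight => //.
  apply: processed_advance lt_t K_list B_list tabK _ _ _ s3_next swept3 s3_tab0.
  - exact: ready_frame fr3 isT rdy2.
  - case: laid2 => [? B_load2 ? ? ?]; split; rewrite ?fr3.1 ?fr3.2 //.
    exact: bag_loaded_frame fr3 isT B_load2.
  - by move=> u; rewrite fr3.2.
have : 0 < 3 ^ w by rewrite expn_gt0.
by rewrite /=; nia.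
Qed.

Lemma run_init_table s : size ss <= h -> (forall x, x \in ts -> 0 < x.2) ->
  graph_loaded s ->
  vars s xNumS = size ss -> vars s xTab = 0 -> vars s xSize = 0 ->
  (forall a, a \in [:: aSeen; aNew; aTab] -> arrs s a = fun=> 0) ->
  run init_table s 20 (processed 0).
Proof.
move=> ss_h ts_pos loaded s_num s_tab s_size arr0.
apply: run_leq (run_straight _ _) _ => //.
have [[s_k s_h] _ _ _ _] := loaded.
have tabE i : (if i == vars s xNumS then vars s xK + 1 else arrs s aTab i)
    = if i == size ss then k.+1 else 0.
  by rewrite s_num s_k arr0 // addn1.
split; [exact: graph_loaded_frame (effect_frame _ _) _ loaded | by [] |].
exists [::]; rewrite /= /upd /=; split.
- exact: lists_alive0.
- by split; rewrite //= /upd /=; case=> // _; rewrite s_h addn1 muln1.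
- by move=> u; rewrite /= /upd /= arr0 // seen0.
- by move=> u; rewrite /= /upd /= arr0.
- rewrite s_tab; split.
    rewrite (_ : table_at _ 0 = fun i => if i == size ss then k.+1 else 0).
      exact: table_correct0.
    exact: functional_extensionality.
  move=> i; rewrite muln1 add0n => lt_i; rewrite tabE ifN //.
  by rewrite neq_ltn (leq_ltn_trans ss_h lt_i) orbT.
Qed.

Lemma run_sum_table s : vars s xH = h ->
  run sum_table s (50 * h.+2) (fun s' => accepts s' <->
    exists2 r, r <= h & 0 < table_at (arrs s aTab) (vars s xTab) r).
Proof.
move=> s_h; set T := table_at _ _.
pose I j s' := vars s' xR = j /\ vars s' xResult = \sum_(r < j) T r.
apply: (@run_for_straight I h.+1) => //.
- by split=> //=; rewrite big_ord0.
- move=> j s' lt_j [fv fa] [r_j res_j]; split.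
    by rewrite /= r_j fv // s_h addn1 subn_eq0 -ltnNge.
  by split; rewrite /= /upd /= r_j ?addn1 // res_j fa // fv // big_ord_recr.
- move=> s' [fv _] [r_j res_j]; rewrite /= r_j fv // s_h addn1 subnn.
  rewrite /accepts res_j sum_nat_eq0 negb_forall.
  split=> //; split=> [/existsP[r]|[r r_h Tr]].
    by rewrite -lt0n => Tr; exists r => //; rewrite -ltnS.
  by apply/existsP; exists (Ordinal (r_h : r < h.+1)); rewrite -lt0n.
- by rewrite /=; lia.
Qed.

Definition input_loaded (s : state) : Prop :=
  [/\ vars s xK = k /\ vars s xH = h,
      vars s xNumS = size ss /\ vars s xNumTs = size ts,
      arrs s aS = nth 0 ss,
      edges_loaded s /\ arrs s aTime = (fun i => (edge i).2)
    & (forall x, 5 < x -> vars s x = 0) /\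
      (forall a, 5 < a -> arrs s a = fun=> 0)].

Definition solve_time (w e : nat) : nat :=
  150 * (size ts + h + 4) +
  max_time ts * (3 ^ w * (700 * (w + e + h + 4)) + 10).

Lemma run_solve s w e : size ss <= h -> (forall x, x \in ts -> 0 < x.2) ->
  (forall t, count (active ts t) (verts ts) <= w) ->
  (forall t, count (fun x => x.2 == t) ts <= e) ->
  input_loaded s ->
  run solve s (solve_time w e)
    (fun s' => accepts s' <-> feasible ss ts k h).
Proof.
move=> ss_h ts_pos w_le e_le.
move=> [[s_k s_h] [s_num s_numt] s_src [[s_u s_v] s_t] [var0 arr0]].
apply: run_leq (run_seq (run_mark_sources s_num s_src _) _) _.
- by rewrite arr0.
- move=> s1 fr1 src1.
  have index1 : run index_edges s1 (100 * (size ts).+1) (indexed (size ts)).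
    apply: run_index_edges; rewrite /edges_loaded ?fr1.1 ?fr1.2 // ?var0 //.
      exact: arr0.
    exact: arr0.
  apply: run_seq index1 _ => s2 fr2 [head2 next2 last2 max2].
  rewrite take_size in last2 max2.
  have [fv fa] := frame_seq fr1 fr2.
  have loaded2 : graph_loaded s2.
    split=> //; [by rewrite !fv | by split; rewrite fa | split=> // u].
    by rewrite fr2.2 // src1.
  apply: run_seq (run_seq (run_init_table ss_h ts_pos loaded2 _ _ _ _) _) _.
  + by rewrite fv.
  + by rewrite fv // var0.
  + by rewrite fv // var0.
  + by move=> a; rewrite !inE => /or3P[]/eqP->; rewrite fa // arr0.
  + move=> s3 fr3 proc3; apply: (run_while (N := max_time ts) proc3).
      move=> t s4 lt_t fr4 proc4; have [_ s4_t _] := proc4; split.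
        by rewrite /= s4_t fr4.1 // fr3.1 // max2 subn_eq0 -ltnNge.
      exact: run_step lt_t (w_le _) (e_le _) proc4.
    move=> s4 fr4 [_ s4_t _].
    by rewrite /= s4_t fr4.1 // fr3.1 // max2 subnn.
  move=> s3 _ [loaded3 _ [K [K_list _ _ _ [tab3 _]]]].
  have [[_ s3_h] _ _ _ _] := loaded3; rewrite (lists_alive_max K_list) in tab3.
  apply: run_weaken (run_sum_table s3_h) (leqnn _) _ => s4 _ ->.
  exact: table_correct_feasible tab3.
- by rewrite /solve_time /=; lia.
Qed.

Lemma run_program s w e T : (forall x, x \in ts -> 0 < x.2) ->
  (forall t, count (active ts t) (verts ts) <= w) ->
  (forall t, count (fun x => x.2 == t) ts <= e) ->
  input_loaded s ->
  (0 < size ss <= h -> 0 < size ts -> solve_time w e <= T) ->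
  run program s (T + 30) (fun s' => accepts s' <-> feasible ss ts k h).
Proof.
move=> ts_pos w_le e_le input solve_le.
have [[_ s_h] [s_num s_numt] _ _ _] := input.
have accept : feasible ss ts k h ->
    run (xResult ::= #1) s 2 (fun s' => accepts s' <-> feasible ss ts k h).
  by move=> feas; apply: run_straight.
apply: run_leq (run_if (t1 := 2) (t2 := T + 20) _ _) _.
- rewrite /= s_num s_h subn_eq0 -ltnNge => ss_gt; apply: run_straight => //.
  by split=> // /feasible_sources_le; rewrite leqNgt ss_gt.
- rewrite /= s_num s_h => /eqP; rewrite subn_eq0 => ss_h.
  apply: run_leq (run_if (t1 := T + 10) (t2 := 2) _ _) _.
  + rewrite /= s_num -lt0n => ss_gt0.
    apply: run_leq (run_if (t1 := T) (t2 := 2) _ _) _.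
    * rewrite /= s_numt -lt0n => ts_gt0.
      by apply: run_leq (solve_le _ ts_gt0);
        [exact: run_solve | rewrite ss_gt0].
    * by rewrite /= s_numt => /size0nil ts0; apply/accept/feasible_no_edge.
    * by rewrite /=; lia.
  + by rewrite /= s_num => /size0nil ss0; apply/accept/feasible_no_source.
  + by rewrite /=; lia.
- by rewrite /=; lia.
Qed.

End Program.

(** * Arrival times in temporal graphs *)

Section TemporalGraph.
Variables (V : finType) (G : tgraph V).
Implicit Types (e S : {set V}) (u v w : V) (p : seq (V * nat)) (t : nat).

Lemma tau_edge e t : t \in tau G e -> e \in edges G.
Proof. by apply: contraTT => /tau_edges ->; rewrite in_fset0. Qed.

Lemma tau_gt0 e t : t \in tau G e -> 0 < t.
Proof. by rewrite lt0n; apply: contraTneq => ->; apply: tau_pos. Qed.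

Lemma tau_card2 e t : t \in tau G e -> #|e| = 2.
Proof. by move/tau_edge/edges_card2. Qed.

Lemma mem_time_edges e t : ((e, t) \in time_edges G) = (t \in tau G e).
Proof.
apply/allpairsPdep/idP => [[e' [t' [_ te' [-> ->]]]] //|te].
by exists e, t; rewrite mem_enum (tau_edge te).
Qed.

Lemma time_edges_uniq : uniq (time_edges G).
Proof.
apply: allpairs_uniq_dep; first exact: enum_uniq.
  by move=> e _; apply: fset_uniq.
by move=> [e t] [e' t'] _ _ /= [-> ->].
Qed.

Lemma tau_le_lifetime e t : t \in tau G e -> t <= lifetime G.
Proof.
move=> te; pose last_tau e := \max_(t <- tau G e) t.
apply: leq_trans (leq_bigmax_cond (F := last_tau) _ (tau_edge te)).
exact: (leq_bigmax_seq (F := id)).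
Qed.

Lemma card_vim_set_le t : #|vim_set G t| <= vimw G.
Proof.
have [->|[v]] := set_0Vmem (vim_set G t); first by rewrite cards0.
rewrite inE => /asboolP[i [j [u [w [it tj iu jw]]]]].
apply: (leq_bigmax_seq (F := fun t => #|vim_set G t|)) => //.
rewrite mem_index_iota ltnS (leq_trans (tau_gt0 iu)) // (leq_trans tj) //.
exact: tau_le_lifetime jw.
Qed.

Lemma is_walk_cat v p p' : is_walk G v (p ++ p') =
  is_walk G v p && is_walk G (last v (unzip1 p)) p'.
Proof. by elim: p v => [|[x t] p IHp] v //=; rewrite IHp andbA. Qed.

Lemma is_walk_rcons v p x t : is_walk G v (rcons p (x, t)) =
  is_walk G v p && (t \in tau G [set last v (unzip1 p); x]).
Proof. by rewrite -cats1 is_walk_cat /= mem_time_edges andbT. Qed.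

Lemma is_walk_path0 v p :
  is_walk G v p -> sorted ltn (unzip2 p) -> path ltn 0 (unzip2 p).
Proof.
case: p => [|[x t] p] //= /andP[te _] ->; rewrite andbT.
by apply: (@tau_gt0 [set v; x]); rewrite -mem_time_edges.
Qed.

Lemma mem_walk_prefix s v p : v \in s :: unzip1 p ->
  exists p1 p2, p = p1 ++ p2 /\ last s (unzip1 p1) = v.
Proof.
elim: p s => [|[x t] p IHp] s.
  by rewrite inE => /eqP->; exists [::], [::].
rewrite inE => /predU1P[->|vp]; first by exists [::], ((x, t) :: p).
by have [p1 [p2 [-> lp]]] := IHp x vp; exists ((x, t) :: p1), p2.
Qed.

Lemma path_ltn_last t (l : seq nat) : path ltn t l -> t <= last t l.
Proof.
elim: l t => [|t' l IHl] t //= /andP[tt' pl].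
exact: leq_trans (ltnW tt') (IHl _ pl).
Qed.

Definition arrives (S : {set V}) t v : Prop :=
  exists s p, [/\ s \in S, temporal_path G s v p & last 0 (unzip2 p) <= t].

Lemma arrives_le S t t' v : t <= t' -> arrives S t v -> arrives S t' v.
Proof.
move=> tt' [s [p [sS tp arr_t]]]; exists s, p; split=> //.
exact: leq_trans tt'.
Qed.

Lemma arrives_reach S t v : arrives S t v -> v \in reach G S.
Proof.
move=> [s [p [sS tp _]]]; rewrite inE; apply/asboolP.
by exists s; last exists p.
Qed.

Lemma arrives_source S t v : v \in S -> arrives S t v.
Proof.
by move=> vS; exists v, [::]; rewrite /temporal_path /temporal_walk /= eqxx.
Qed.

(* The path to u either avoids v, and is extended by the time-edge, or visits v
   already. *)
Lemma arrives_step S t' t u v : arrives S t' u -> t' < t ->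
  t \in tau G [set u; v] -> arrives S t v.
Proof.
move=> [s [p [sS /andP[/and3P[wp sp /eqP lp] up] arr_t]]] tt' te.
have path_p := is_walk_path0 wp sp.
have [/mem_walk_prefix[p1 [p2 [pE lp1]]]|vp] := boolP (v \in s :: unzip1 p).
  rewrite {}pE /unzip1 /unzip2 !map_cat in wp up path_p arr_t.
  move: wp up path_p arr_t.
  rewrite is_walk_cat -cat_cons cat_uniq cat_path last_cat.
  move=> /andP[wp1 _] /and3P[up1 _ _] /andP[path_p1].
  move=> /path_ltn_last prefix_le arr_t.
  have t1_le := leq_trans prefix_le (leq_trans arr_t (ltnW tt')).
  exists s, p1; split=> //.
  by rewrite /temporal_path /temporal_walk wp1 (path_sorted path_p1) lp1 eqxx.
exists s, (rcons p (v, t)); split=> //; last first.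
  by rewrite /unzip2 map_rcons last_rcons.
rewrite /temporal_path /temporal_walk is_walk_rcons wp lp te.
rewrite /unzip1 /unzip2 !map_rcons.
rewrite last_rcons eqxx -rcons_cons rcons_uniq vp up !andbT /=.
by apply: (@path_sorted _ _ 0); rewrite rcons_path path_p;
  apply: leq_ltn_trans tt'.
Qed.

Lemma arrives_last S t v : v \notin S -> arrives S t v ->
  exists w t', [/\ t' <= t, t' \in tau G [set w; v] & arrives S t' v].
Proof.
move=> vS [s [p [sS tp]]]; have /andP[/and3P[wp sp lp] _] := tp.
case/lastP: p wp sp lp tp => [|p [x t']] wp sp.
  by move=> /eqP /= sv; rewrite -sv sS in vS.
rewrite {1}/unzip1 map_rcons last_rcons => /eqP /= xv tp.
rewrite /unzip2 map_rcons last_rcons => arr_t; rewrite is_walk_rcons xv in wp.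
case/andP: wp => _ te; exists (last s (unzip1 p)), t'; split=> //.
by exists s, (rcons p (x, t')); rewrite /unzip2 map_rcons last_rcons.
Qed.

(* Equal to [L.+1] if v is not reached by time L. *)
Definition arrival (S : {set V}) (L : nat) v : nat :=
  find (fun t => `[< arrives S t v >]) (iota 0 L.+1).

Lemma arrivalP S L t v : t <= L -> arrival S L v <= t <-> arrives S t v.
Proof.
move=> t_le; split=> [le_t|arr].
  have : has (fun t => `[< arrives S t v >]) (iota 0 L.+1).
    by rewrite has_find size_iota (leq_ltn_trans le_t).
  move/(nth_find 0); rewrite nth_iota ?add0n; last exact: leq_ltn_trans le_t _.
  by move/asboolP; apply: arrives_le.
rewrite leqNgt; apply/negP => /[dup] /(before_find 0) + _.
by rewrite nth_iota // add0n => /asboolP.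
Qed.

Lemma arrival_source S L v : v \in S -> arrival S L v = 0.
Proof.
move=> vS; apply/eqP; rewrite -leqn0; apply/arrivalP => //.
exact: arrives_source.
Qed.

End TemporalGraph.

(** * Optimal deletions and infection times *)

Definition time_edge (V : finType) (x : V * V * nat) : {set V} * nat :=
  ([set x.1.1; x.1.2]%SET, x.2).

Section Encoding.
Variables (V : finType) (G : tgraph V) (S : {set V}).
Variables (ss : seq V) (ts : seq (V * V * nat)).
Hypotheses (ss_enum : perm_eq ss (enum S))
  (ts_enum : perm_eq (map (@time_edge V) ts) (time_edges G)).
Implicit Types (D : {fset {set V} * nat}) (f : V -> nat) (u v : V) (t : nat).

Lemma mem_sources v : (v \in ss) = (v \in S).
Proof. by rewrite (perm_mem ss_enum) mem_enum. Qed.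

Lemma uniq_map_time_edge : uniq (map (@time_edge V) ts).
Proof. by rewrite (perm_uniq ts_enum) time_edges_uniq. Qed.

Lemma mem_ts_tau x : x \in ts -> x.2 \in tau G [set x.1.1; x.1.2].
Proof.
move=> xts; rewrite -mem_time_edges -(perm_mem ts_enum).
exact: (map_f (@time_edge V)).
Qed.

Lemma tau_mem_ts u v t : t \in tau G [set u; v] ->
  exists x, [/\ x \in ts, time_edge x = ([set u; v]%SET, t)
    & x.1 = (u, v) \/ x.1 = (v, u)].
Proof.
move=> tuv; have := tuv.
rewrite -mem_time_edges -(perm_mem ts_enum) => /mapP[x xts xE].
exists x; split=> //; have [uv_eq _] := xE.
have uv : u != v by have := tau_card2 tuv; rewrite cards2; case: eqP.
have := set22 u v; have := set21 u v; rewrite uv_eq !inE.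
rewrite [x.1]surjective_pairing => /orP[]/eqP uE /orP[]/eqP vE.
- by rewrite uE vE eqxx in uv.
- by rewrite uE vE; left.
- by rewrite uE vE; right.
- by rewrite uE vE eqxx in uv.
Qed.

Lemma mem_ts_gt0 x : x \in ts -> 0 < x.2.
Proof. by move/mem_ts_tau/tau_gt0. Qed.

Lemma max_time_le_lifetime : max_time ts <= lifetime G.
Proof. by apply/bigmax_leqP_seq => x /mem_ts_tau/tau_le_lifetime. Qed.

Lemma tau_le_max_time u v t : t \in tau G [set u; v] -> t <= max_time ts.
Proof. by case/tau_mem_ts=> x [xts [_ <-] _]; apply: time_le_max. Qed.

Lemma end_tau x u : x \in ts -> u \in ends x ->
  exists w, x.2 \in tau G [set w; u].
Proof.
move=> /mem_ts_tau tx; rewrite !inE => /orP[]/eqP->; last by exists x.1.1.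
by exists x.1.2; rewrite setUC.
Qed.

Lemma active_vim_set t u : active ts t u -> u \in vim_set G t.
Proof.
have [->|t_gt0] := posnP t.
  by rewrite /active seen0 //; apply: mem_ts_gt0.
case/(activeP _ _ t_gt0)=> x [y [xts yts ux uy /andP[xt ty]]].
rewrite inE; apply/asboolP.
have [w xw] := end_tau xts ux; have [w' yw'] := end_tau yts uy.
by exists x.2, y.2, w, w'.
Qed.

Lemma count_active_le t : count (active ts t) (verts ts) <= vimw G.
Proof.
apply: leq_trans (card_vim_set_le G t); rewrite cardE -size_filter.
apply: uniq_leq_size => [|u]; first by rewrite filter_uniq ?undup_uniq.
by rewrite mem_filter mem_enum => /andP[/active_vim_set].
Qed.

Lemma end_vim_set x u : x \in ts -> u \in ends x -> u \in vim_set G x.2.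
Proof. by move=> xts ux; apply/active_vim_set/active_end. Qed.

Lemma count_simultaneous_le t : count (fun x => x.2 == t) ts <= vimw G ^ 2.
Proof.
apply: (@leq_trans (#|vim_set G t| * #|vim_set G t|)); last first.
  by rewrite mulnn leq_sqr card_vim_set_le.
rewrite -size_filter -cardsX cardE -(size_map (fun x => x.1)).
apply: uniq_leq_size.
  rewrite map_inj_in_uniq ?filter_uniq ?(map_uniq uniq_map_time_edge) // => x y.
  rewrite !mem_filter /= => /andP[/eqP xt _] /andP[/eqP yt _].
  by case: x y xt yt => [x1 x2] [y1 y2] /= -> -> ->.
move=> _ /mapP[x + ->]; rewrite mem_filter mem_enum => /andP[/eqP <- xts].
by rewrite [x.1]surjective_pairing in_setX !end_vim_set // !inE eqxx ?orbT.
Qed.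

Lemma size_ts_le : size ts <= vimw G ^ 2 * lifetime G.
Proof.
have -> : size ts =
    \sum_(1 <= t < (lifetime G).+1) count (fun x => x.2 == t) ts.
  rewrite -sum1_size; under [RHS]eq_bigr do rewrite -sum1_count big_mkcond.
  rewrite exchange_big /=; apply: eq_big_seq => x xts.
  rewrite -big_mkcond sum1_count (eq_count (a2 := pred1 x.2)) //.
  rewrite count_uniq_mem ?iota_uniq // mem_index_iota mem_ts_gt0 //= ltnS.
  by rewrite (leq_trans (time_le_max xts) max_time_le_lifetime).
apply: (@leq_trans (\sum_(1 <= t < (lifetime G).+1) vimw G ^ 2)).
  by apply: leq_sum => t _; apply: count_simultaneous_le.
by rewrite sum_nat_const_nat subn1 mulnC.
Qed.

Lemma vimw_ge2 : 0 < size ts -> 2 <= vimw G.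
Proof.
case E: ts => [//|x l] _; have xts : x \in ts by rewrite E mem_head.
rewrite -(tau_card2 (mem_ts_tau xts)); apply: leq_trans (card_vim_set_le G x.2).
apply/subset_leq_card/subsetP => v; rewrite in_set2 => v_x.
by apply: end_vim_set xts _; rewrite !inE.
Qed.

Lemma infected_card f : admissible ss ts f ->
  infected ss ts (max_time ts) f = #|[set v | f v <= max_time ts]|.
Proof.
case=> src_f adm_f; rewrite cardE /infected -size_filter -size_cat.
apply/perm_size/uniq_perm => [||v].
- rewrite cat_uniq (perm_uniq ss_enum) enum_uniq.
  rewrite filter_uniq ?undup_uniq // andbT.
  by apply/hasPn => u; rewrite mem_filter => /andP[/andP[]].
- exact: enum_uniq.
- rewrite mem_cat mem_filter mem_enum inE.
  have [vss|vss] := boolP (v \in ss); first by rewrite src_f.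
  have [_ /= act] := adm_f v vss; case: leqP => //= fv.
  by rewrite (active_verts (act fv)).
Qed.

Lemma deletions_count f : deletions ts (max_time ts) f = count (cut f) ts.
Proof.
by apply: eq_in_count => x xts; rewrite time_le_max.
Qed.

Lemma walk_infected D f p v t :
  (forall x, x \in ts -> cut f x -> time_edge x \in D) ->
  f v <= t -> is_walk (delete G D) v p -> path ltn t (unzip2 p) ->
  f (last v (unzip1 p)) <= last t (unzip2 p).
Proof.
move=> cutD; elim: p v t => [|[x t'] p IHp] v t //= fv.
move=> /andP[te wp] /andP[tt' pp].
apply: IHp => //; move: te; rewrite mem_time_edges !inE /= => /andP[te].
have [y [yts yE y_uv]] := tau_mem_ts te; rewrite -yE [_ <= t']leqNgt.
apply: contraNN => fx; apply: cutD => //; have [_ yt] := yE; rewrite /cut yt.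
by case: y_uv => -> /=; lia.
Qed.

Lemma walk_last_le_max D v p :
  is_walk (delete G D) v p -> last 0 (unzip2 p) <= max_time ts.
Proof.
case/lastP: p => // p [x t]; rewrite is_walk_rcons !inE => /andP[_ /andP[te _]].
by rewrite /unzip2 map_rcons last_rcons (tau_le_max_time te).
Qed.

Lemma reach_infected D f : admissible ss ts f ->
  (forall x, x \in ts -> cut f x -> time_edge x \in D) ->
  reach (delete G D) S \subset [set v | f v <= max_time ts].
Proof.
move=> [src_f _] cutD; apply/subsetP => v; rewrite !inE.
case/asboolP=> s sS [p /andP[/and3P[wp sp /eqP <-] _]].
apply: leq_trans (walk_last_le_max wp).
by apply: walk_infected cutD _ wp (is_walk_path0 wp sp);
  rewrite src_f ?mem_sources.
Qed.

Lemma admissible_arrival D :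
  admissible ss ts (arrival (delete G D) S (max_time ts)).
Proof.
set L := max_time ts; split=> v; rewrite mem_sources => vS.
  exact: arrival_source.
have infection t : t <= L -> arrives (delete G D) S t v -> exists2 t',
    t' <= t & [/\ 0 < t', active ts t' v & arrival (delete G D) S L v <= t'].
  move=> t_le /(arrives_last vS)[w [t' [t'_le te arr]]]; exists t' => //.
  move: te; rewrite !inE => /andP[te _].
  have [x [xts [_ xt] x_wv]] := tau_mem_ts te.
  split; first exact: tau_gt0 te.
    rewrite -xt active_end //.
    by case: x_wv => xE; rewrite /ends xE !inE eqxx ?orbT.
  by apply/arrivalP; rewrite // (leq_trans t'_le).
split=> [|arr_le].
  rewrite lt0n; apply/negP => /eqP arr0.
  have /arrivalP : arrival (delete G D) S L v <= 0 by rewrite arr0.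
  by case/(_ (leq0n L))/(infection 0)=> // t'; rewrite leqn0 => /eqP-> [].
have arr := proj1 (arrivalP _ _ _ arr_le) (leqnn _).
have [t' t'_le [_ act arr_t']] := infection _ arr_le arr.
suff -> : arrival (delete G D) S L v = t' by [].
by apply/eqP; rewrite eqn_leq arr_t' t'_le.
Qed.

Lemma infected_arrival_reach D :
  [set v | arrival (delete G D) S (max_time ts) v <= max_time ts]
    \subset reach (delete G D) S.
Proof.
apply/subsetP => v; rewrite inE => /(arrivalP _ _ _ (leqnn _)).
exact: arrives_reach.
Qed.

Lemma cut_arrival_deleted D x : x \in ts ->
  cut (arrival (delete G D) S (max_time ts)) x -> time_edge x \in D.
Proof.
move=> xts; have tx := mem_ts_tau xts; apply: contraTT => xD.
have te : x.2 \in tau (delete G D) [set x.1.1; x.1.2] by rewrite !inE /= tx.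
have x_le := tau_le_max_time tx; set f := arrival _ _ _.
have infect u v :
    x.2 \in tau (delete G D) [set u; v] -> f u < x.2 -> f v <= x.2.
  move=> tuv fu; apply/arrivalP => //.
  have fu_le := leq_trans (ltnW fu) x_le.
  by apply: (arrives_step _ fu tuv); apply/(arrivalP _ _ _ fu_le).
have infect_r := infect _ _ te.
rewrite setUC in te; have infect_l := infect _ _ te.
by apply/norP; split; apply/nandP; rewrite -!leqNgt; case: leqP; auto.
Qed.

Lemma feasible_MinReachDelete k h :
  feasible ss ts k h <-> MinReachDelete G S k h.
Proof.
split=> [[f [adm_f]]|[D [_ D_le reach_le]]].
  rewrite infected_card // deletions_count => inf_f cut_f.
  pose D := [fset y in map (@time_edge V) (filter (cut f) ts)]%fset; exists D.
  split.
  - move=> y; rewrite !inE => /mapP[x]; rewrite mem_filter => /andP[_ xts] ->.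
    by rewrite mem_time_edges mem_ts_tau.
  - by rewrite card_fseq (leq_trans (size_undup _)) // size_map size_filter.
  - apply: leq_trans inf_f; apply/subset_leq_card/(reach_infected adm_f).
    by move=> x xts fx; rewrite inE map_f // mem_filter fx.
exists (arrival (delete G D) S (max_time ts)); split.
- exact: admissible_arrival.
- rewrite infected_card; last exact: admissible_arrival.
  exact: leq_trans (subset_leq_card (infected_arrival_reach D)) reach_le.
- apply: leq_trans D_le; rewrite deletions_count -size_filter.
  rewrite -(size_map (@time_edge V));
    apply: uniq_leq_size => [|_ /mapP[x + ->]].
    exact: subseq_uniq (map_subseq _ (filter_subseq _ _)) uniq_map_time_edge.
  by rewrite mem_filter => /andP[fx xts]; apply: cut_arrival_deleted xts fx.
Qed.

End Encoding.

Lemma exp3_le_exp2_square w : 2 <= w -> 3 ^ w <= 2 ^ (w ^ 2).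
Proof.
move=> w_ge2; apply: (@leq_trans (4 ^ w)); first by rewrite leq_exp2r //; lia.
by rewrite -[4]/(2 ^ 2) -expnM leq_pexp2l // -mulnn leq_mul2r w_ge2 orbT.
Qed.

Lemma solve_time_le w h L (ts : seq (nat * nat * nat)) :
  2 <= w -> 0 < h -> 0 < L -> max_time ts <= L -> size ts <= w ^ 2 * L ->
  solve_time h ts w (w ^ 2) <= 4000 * (w ^ 2 * h * 2 ^ (w ^ 2) * L).
Proof.
move=> w_ge2 h_gt0 L_gt0 max_le size_le; set Y := _ * L.
have pow_gt0 : 0 < 2 ^ (w ^ 2) by rewrite expn_gt0.
have w_sq : w * 2 <= w ^ 2 by rewrite -mulnn leq_mul2l w_ge2 orbT.
have qh_Y : w ^ 2 * h <= Y by rewrite /Y -mulnA leq_pmulr // muln_gt0 pow_gt0.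
have q_qh : w ^ 2 <= w ^ 2 * h by rewrite leq_pmulr.
have h_qh : h <= w ^ 2 * h by rewrite leq_pmull //; lia.
have size_Y : size ts <= Y.
  apply: leq_trans size_le _; rewrite /Y leq_mul2r -mulnA leq_pmulr ?orbT //.
  by rewrite muln_gt0 h_gt0.
have L_Y : L <= Y by rewrite /Y leq_pmull // !muln_gt0 h_gt0 pow_gt0; lia.
have steps_Y :
    max_time ts * (3 ^ w * (700 * (w + w ^ 2 + h + 4)) + 10) <= 2810 * Y.
  apply: (@leq_trans (L * (2 ^ (w ^ 2) * (700 * (4 * (w ^ 2 * h))) + 10))).
    rewrite leq_mul // leq_add2r leq_mul ?exp3_le_exp2_square // leq_mul2l /=.
    by lia.
  by rewrite mulnDr (_ : L * (2 ^ (w ^ 2) * _) = 2800 * Y); rewrite /Y; lia.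
by rewrite /solve_time; lia.
Qed.

Lemma input_state_loaded n (ss : seq 'I_n) es (ts : seq ('I_n * 'I_n * nat))
    k h :
  input_loaded k h (map val ss) (map (relabel val) ts)
    (input_state k h ss es ts).
Proof.
have nth_ts (g : 'I_n * 'I_n * nat -> nat) g' : g' (0, 0, 0) = 0 ->
    (forall x, g x = g' (relabel val x)) ->
    nth 0 [seq g x | x <- ts] = fun i =>
      g' (nth (0, 0, 0) (map (relabel val) ts) i).
  move=> g'0 gE; apply: functional_extensionality.
  by elim: (ts) => [|x l IHl] [|i] //=; rewrite ?g'0 // gE.
split; rewrite /= ?size_map //.
- split; last exact: (nth_ts _ (fun x => x.2)).
  split; first exact: (nth_ts _ (fun x => x.1.1)).
  exact: (nth_ts _ (fun x => x.1.2)).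
- split=> [x x_gt5|a a_gt5]; first by rewrite nth_default.
  apply: functional_extensionality => i.
  by rewrite [nth [::] _ a]nth_default ?nth_nil.
Qed.

Theorem theorem6p4 :
  exists (c : cmd) (C : nat),
    forall (n : nat) (G : tgraph 'I_n) (S : {set 'I_n}) (k h : nat) (s : state),
      encodes G S k h s ->
      exists (T : nat) (s' : state),
        [/\ exec c s T s',
            accepts s' <-> MinReachDelete G S k h
          & T <= C * (vimw G ^ 2 * h * 2 ^ (vimw G ^ 2) * lifetime G + 1)].
Proof.
exists program, 4030 => n G S k h _ [ss [es [ts [ss_enum _ ts_enum ->]]]].
set X := _ * lifetime G; pose ts' := map (relabel val) ts.
have ts_gt0 : {in ts, forall x, 0 < x.2}.
  by move=> x; apply: mem_ts_gt0 ts_enum x.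
have max_le := max_time_le_lifetime ts_enum.
have [T [s' [ex T_le acc]]] :
    run program (input_state k h ss es ts) (4000 * X + 30)
      (fun s' => accepts s' <-> feasible (map val ss) ts' k h).
  apply: (@run_program _ _ _ _ _ (vimw G) (vimw G ^ 2)) => [|t|t||].
  - by move=> _ /mapP[x /ts_gt0 x_gt0 ->].
  - by rewrite count_active_map ?count_active_le //; apply: val_inj.
  - by rewrite count_map; apply: count_simultaneous_le ts_enum t.
  - exact: input_state_loaded.
  rewrite !size_map => /andP[ss_gt0 ss_h] ts_neq0.
  apply: solve_time_le; rewrite ?max_time_map ?size_map //.
  - exact: (vimw_ge2 ts_enum).
  - exact: leq_trans ss_h.
  - exact: leq_trans (max_time_gt0 ts_gt0 ts_neq0) max_le.
  - exact: (size_ts_le ts_enum).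
exists T, s'; split=> //; last by lia.
apply: (iff_trans acc); apply: iff_trans (feasible_map val_inj ss ts k h) _.
exact: feasible_MinReachDelete.
Qed.
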